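(* Let $\Bbbk$ be a commutative ring and let $(R,C,\partial)$ be a Poisson order over $\Bbbk$. (1) If $R$ is a free $C$-module, then $(R,C,\partial,\mathrm{tr}_{\mathrm{reg}})$ is a Poisson trace order, where $\mathrm{tr}_{\mathrm{reg}}:R\to C$ is the regular trace. (2) If $R$ is a prime PI algebra and $C=\mathcal{Z}(R)$ is the full center of $R$ and is normal, then $(R,C,\partial,\mathrm{tr}_{\mathrm{red}})$ is a Poisson trace order, where $\mathrm{tr}_{\mathrm{red}}:R\to\mathcal{Z}(R)$ is the reduced trace.
   Context: $\Bbbk$ is a commutative base ring; algebras are associative unital $\Bbbk$-algebras and Poisson algebras are commutative with $\Bbbk$-bilinear Poisson bracket. $\mathrm{Der}_\Bbbk(R)$ denotes $\Bbbk$-linear derivations of $R$. Poisson order: a triple $(R,C,\partial)$ where $C$ is a central $\Bbbk$-subalgebra of the $\Bbbk$-algebra $R$, $R$ is a finitely generated $C$-module, $C$ is equipped with a Poisson algebra structure $\{.,.\}$, and $\partial:C\to\mathrm{Der}_\Bbbk(R)$, $c\mapsto\partial_c$, is a $\Bbbk$-linear map such that $\partial_c|_C=\{c,-\}$ for all $c\in C$. Trace map: a map $\mathrm{tr}:R\to C$ that is $C$-linear and satisfies $\mathrm{tr}(xy)=\mathrm{tr}(yx)$ for all $x,y\in R$. Poisson trace order: a quadruple $(R,C,\partial,\mathrm{tr})$ with $(R,C,\partial)$ a Poisson order and $\mathrm{tr}:R\to C$ a trace map such that $\mathrm{tr}(\partial_c(r))=\{c,\mathrm{tr}(r)\}$ for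 all $c\in C$, $r\in R$. Regular trace: if $R$ is a free $C$-module of finite rank $n$, $\mathrm{tr}_{\mathrm{reg}}$ is the composition $R\to\mathrm{End}_C(R)\cong M_n(C)\to C$, the first map being left multiplication, the second coming from a choice of $C$-basis of $R$, the third the matrix trace (independent of the basis). Reduced trace: let $R$ be prime and finitely generated as a module over its center $\mathcal{Z}(R)$, and let $Q$ be the fraction field of the integral domain $\mathcal{Z}(R)$. Then $R\otimes_{\mathcal{Z}(R)}Q$ is a central simple $Q$-algebra; choose a finite field extension $F/Q$ with $R\otimes_{\mathcal{Z}(R)}F\cong M_n(F)$. The reduced trace is the composition $R\hookrightarrow R\otimes_{\mathcal{Z}(R)}Q\to R\otimes_{\mathcal{Z}(R)}F\cong M_n(F)\to F$ with last map the matrix trace; it takes values in $Q$, is independent of choices, and takes values in $\mathcal{Z}(R)$ when $\mathcal{Z}(R)$ is normal (i.e. integrally closed in $Q$). *)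

(* Defs.v *)
(* Throughout, k is the base ring, R a k-algebra, and a
   central k-subalgebra C of R is given as a commutative k-algebra together
   with an injective k-algebra morphism iota : C -> R with central image; the
   C-module structure of R is c . r = iota c * r. *)
From HB Require Import structures.
From mathcomp Require Import all_boot all_order all_algebra all_field.
From mathcomp Require Import finmap.
From mathcomp.multinomials Require Import monalg.

Set Implicit Arguments.
Unset Strict Implicit.
Unset Printing Implicit Defensive.

Import GRing.Theory.
Local Open Scope ring_scope.

Section PoissonOrders.
Variables (k : comNzRingType) (R : algType k) (C : comAlgType k).
Variable iota : {lrmorphism C -> R}.

Definition central_subalgebra : Prop :=
  injective iota /\ forall (c : C) (r : R), iota c * r = r * iota c.

Definition module_finitely_generated : Prop :=
  exists (n : nat) (g : 'I_n -> R),
    forall r : R, exists a : 'I_n -> C, r = \sum_(i < n) iota (a i) * g i.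

(* The bracket is required to be alternating, not merely antisymmetric, since 2
   need not be invertible in k. *)
Record poisson_bracket (br : C -> C -> C) : Prop := PoissonBracket {
  bracket_linearr : forall a, linear (br a);
  bracket_linearl : forall b, linear (br^~ b);
  bracket_alternating : forall a, br a a = 0;
  bracket_jacobi : forall a b c,
    br a (br b c) + br b (br c a) + br c (br a b) = 0;
  bracket_leibniz : forall a b c, br a (b * c) = br a b * c + b * br a c
}.

Definition derivation (D : R -> R) : Prop :=
  linear D /\ forall x y, D (x * y) = D x * y + x * D y.

Record poisson_order (br : C -> C -> C) (d : C -> R -> R) : Prop :=
  PoissonOrder {
    order_central : central_subalgebra;
    order_finite : module_finitely_generated;
    order_bracket : poisson_bracket br;
    order_derivation : forall c, derivation (d c);
    order_linear : forall r, linear (d^~ r);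
    order_restrict : forall c a, d c (iota a) = iota (br c a)
  }.

Definition trace_map (tr : R -> C) : Prop :=
  (forall (a : C) (x y : R), tr (iota a * x + y) = a * tr x + tr y) /\
  (forall x y : R, tr (x * y) = tr (y * x)).

Definition poisson_trace_order
    (br : C -> C -> C) (d : C -> R -> R) (tr : R -> C) : Prop :=
  [/\ poisson_order br d,
      trace_map tr &
      forall (c : C) (r : R), tr (d c r) = br c (tr r)].

Definition module_basis (I : choiceType) (b : I -> R) : Prop :=
  (forall r : R, exists (s : seq I) (a : I -> C),
     r = \sum_(i <- s) iota (a i) * b i) /\
  (forall (s : seq I) (a : I -> C), uniq s ->
     \sum_(i <- s) iota (a i) * b i = 0 -> forall i, i \in s -> a i = 0).

Definition free_module : Prop :=
  exists (I : choiceType) (b : I -> R), module_basis b.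

(* M is the matrix of left multiplication by r in the basis b: its j-th column
   holds the coordinates of r * b j. *)
Definition is_regular_trace (tr : R -> C) : Prop :=
  exists (n : nat) (b : 'I_n -> R), module_basis b /\
    forall r : R, exists M : 'M[C]_n,
      (forall j, r * b j = \sum_(i < n) iota (M i j) * b i) /\ tr r = \tr M.

Definition full_center : Prop :=
  forall z : R, (forall r : R, z * r = r * z) -> exists c : C, z = iota c.

End PoissonOrders.

Definition prime_ring (R : nzRingType) : Prop :=
  forall a b : R, (forall x : R, a * x * b = 0) -> a = 0 \/ b = 0.

(* A polynomial identity algebra: some noncommutative polynomial over k, monic
   in the sense that one of its monomials of highest degree has coefficient 1,
   vanishes under every substitution of elements of R for its variables. *)
Definition pi_algebra (k : comNzRingType) (R : algType k) : Prop :=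
  exists (n : nat) (f : {malg k[{fmonom 'I_n}]}),
    (exists m : {fmonom 'I_n},
       f@_m = 1 /\ forall m', m' \in msupp f -> (fdeg m' <= fdeg m)%N) /\
    forall x : 'I_n -> R,
      \sum_(m <- msupp f) f@_m *: \prod_(i <- fmonom_val m) x i = 0.

Definition is_fraction_field
    (C : comNzRingType) (Q : fieldType) (q : {rmorphism C -> Q}) : Prop :=
  injective q /\ forall x : Q, exists a b : C, b != 0 /\ x = q a / q b.

Definition normal_domain (C : comNzRingType) : Prop :=
  exists (Q : fieldType) (q : {rmorphism C -> Q}), is_fraction_field q /\
    forall x : Q, integralOver q x -> exists c : C, x = q c.

(* The tensor product of the S-modules M and N, through its universal property:
   t is the universal biadditive S-balanced map on M x N, where smulM and smulN
   are the scalar multiplications. *)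
Definition balanced (S : Type) (M N V : zmodType)
    (smulM : S -> M -> M) (smulN : S -> N -> N) (f : M -> N -> V) : Prop :=
  [/\ forall x x' y, f (x + x') y = f x y + f x' y,
      forall x y y', f x (y + y') = f x y + f x y' &
      forall s x y, f (smulM s x) y = f x (smulN s y)].

Definition is_tensor_product (S : Type) (M N T : zmodType)
    (smulM : S -> M -> M) (smulN : S -> N -> N) (t : M -> N -> T) : Prop :=
  balanced smulM smulN t /\
  forall (V : zmodType) (f : M -> N -> V), balanced smulM smulN f ->
    exists g : {additive T -> V}, (forall x y, g (t x y) = f x y) /\
      forall h : {additive T -> V}, (forall x y, h (t x y) = f x y) -> h =1 g.

Section ReducedTrace.
Variables (k : comNzRingType) (R : algType k) (C : comAlgType k).
Variable iota : {lrmorphism C -> R}.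

(* An isomorphism of F-algebras from the tensor product of R and F over C to
   'M[F]_n is determined by its restriction phi to R: it maps the tensor of r
   and x to x *: phi r.  So such an isomorphism amounts to a morphism phi for
   which 'M[F]_n, with this map, is a tensor product of R and F over C.  Here F
   is a finite extension of Q, hence a C-module through q. *)
Definition splitting (Q : fieldType) (q : {rmorphism C -> Q})
    (F : fieldExtType Q) (n : nat) (phi : {rmorphism R -> 'M[F]_n}) : Prop :=
  is_tensor_product
    (fun (c : C) (r : R) => iota c * r)
    (fun (c : C) (x : F) => q c *: x)
    (fun (r : R) (x : F) => x *: phi r).

(* For C the full center of R. *)
Definition is_reduced_trace (tr : R -> C) : Prop :=
  exists (Q : fieldType) (q : {rmorphism C -> Q}) (F : fieldExtType Q)
         (n : nat) (phi : {rmorphism R -> 'M[F]_n}),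
    [/\ is_fraction_field q,
        splitting q phi &
        forall r : R, (q (tr r))%:A = \tr (phi r)].

End ReducedTrace.

(* Main.v *)
(* The regular trace: if M is the matrix of left multiplication by r in a
   C-basis b, and D the matrix of d c on b, then differentiating r b = b M shows
   that d c r has matrix {c, M} + D M - M D, whose trace is {c, tr M}.

   The reduced trace, compatibility: theta r = tr (d c r) - {c, tr r} is
   C-linear and vanishes on commutators, so it is lam * tr for a constant lam.
   If n is nonzero in F, evaluate at 1.  In characteristic p, theta (r ^ p) = 0
   while tr (r ^ p) = (tr r) ^ p, so lam = 0 as well.  No derivation has to be
   extended to the splitting field, which may be inseparable over Q.

   The reduced trace, existence: the localization A of R at C is a prime
   algebra of finite dimension over Q with center Q.  A representation of A of
   minimal degree over all finite extensions of Q is absolutely irreducible,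
   and faithful after extension of scalars because the multiplication algebra
   of A separates linearly independent elements.  Traces lie on a Q-line u Q of
   F by uniqueness of traces.  In characteristic p, tr (r ^ p) = (tr r) ^ p puts
   (tr r) ^ (p - 1) in Q for tr r <> 0, and the characteristic polynomial of left
   multiplication by r on A, which is the n-th power of that of phi r, puts a
   p-power of tr r in Q; hence u may be taken in Q.  Finally traces are integral
   over C since the eigenvalues of phi r are, and C is normal. *)
From HB Require Import structures.
Require Import Defs.
From mathcomp Require Import all_boot all_order all_algebra all_field.
From mathcomp Require Import boolp.

Set Implicit Arguments.
Unset Strict Implicit.
Unset Printing Implicit Defensive.

Import GRing.Theory.
Local Open Scope ring_scope.

(** * Regular trace *)

Section RegularTrace.
Variables (k : comNzRingType) (R : algType k) (C : comAlgType k).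
Variable iota : {lrmorphism C -> R}.

Lemma module_basis_seq (I : choiceType) (b : I -> R) (s : seq I) :
  module_basis iota b -> uniq s ->
  (forall r, exists a : I -> C, r = \sum_(i <- s) iota (a i) * b i) ->
  exists b' : 'I_(size s) -> R, module_basis iota b'.
Proof.
move=> [_ bfree] s_uniq sgen; exists (fun i => b (tnth (in_tuple s) i)); split.
  move=> r; have [a ->] := sgen r.
  exists (index_enum 'I_(size s)), (fun i => a (tnth (in_tuple s) i)).
  by rewrite big_tnth.
move=> t a t_uniq sum0 i it.
(* Carries coefficients from positions of [s] back to [I], with 0 off [s]; well defined since [s]
   has no repetition. *)
pose ci j := if [pick l | tnth (in_tuple s) l == j] is Some l then a l else 0.
have inj_s : injective (tnth (in_tuple s)) by apply/tuple_uniqP.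
have ciE l : ci (tnth (in_tuple s) l) = a l.
  rewrite /ci; case: pickP => [l' /eqP/inj_s -> //|/(_ l)].
  by rewrite eqxx.
rewrite -ciE; apply: (bfree [seq tnth (in_tuple s) l | l <- t]).
- by rewrite map_inj_uniq.
- by rewrite big_map -[RHS]sum0; apply: eq_bigr => l _; rewrite ciE.
- by rewrite map_f.
Qed.

(** Each of the finitely many generators involves finitely many basis elements, and these together
    already generate R. *)
Lemma finite_basis :
  module_finitely_generated iota -> free_module iota ->
  exists (n : nat) (b : 'I_n -> R), module_basis iota b.
Proof.
move=> [m [g ggen]] [I [b bb]]; have [bgen _] := bb.
have /choice[s /choice[a gE]] j := bgen (g j).
pose S := undup (flatten [seq s j | j <- enum 'I_m]).
exists (size S); apply: (module_basis_seq bb); first exact: undup_uniq.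
move=> r; have [c ->] := ggen r.
(* The expansion of [g j] may list an index several times, hence the multiplicity of [i] in
   [s j]. *)
exists (fun i => \sum_j c j * ((count_mem i (s j))%:R * a j i)).
transitivity (\sum_j \sum_(i <- S)
    iota (c j * ((count_mem i (s j))%:R * a j i)) * b i); last first.
  rewrite exchange_big; apply: eq_bigr => i _ /=.
  by rewrite rmorph_sum mulr_suml.
apply: eq_bigr => j _; rewrite {1}gE mulr_sumr.
under [RHS]eq_bigr do rewrite rmorphM -mulrA.
rewrite -!mulr_sumr; congr (_ * _).
have sS : {subset s j <= S}.
  move=> i ij; rewrite mem_undup; apply/flattenP; exists (s j) => //.
  by rewrite map_f ?mem_enum.
elim: (s j) sS => [|x t IHt] sS /=.
  by rewrite big_nil big1 // => i _; rewrite /= mul0r rmorph0 mul0r.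
rewrite big_cons IHt => [|i it]; last by rewrite sS // inE it orbT.
under [RHS]eq_bigr do rewrite natrD mulrDl rmorphD mulrDl.
rewrite big_split /=; congr (_ + _).
rewrite (bigD1_seq x) ?undup_uniq ?sS ?mem_head //= eqxx mul1r.
rewrite big1 ?addr0 // => i /negPf; rewrite eq_sym => ->.
by rewrite mul0r rmorph0 mul0r.
Qed.

Lemma basis_coord (n : nat) (b : 'I_n -> R) : module_basis iota b ->
  forall r, exists a : 'I_n -> C, r = \sum_i iota (a i) * b i.
Proof.
move=> [bgen _] r; have [s [a ->]] := bgen r.
exists (fun i => (count_mem i s)%:R * a i).
elim: s => [|x s IHs] /=.
  by rewrite big_nil big1 // => i _; rewrite /= mul0r rmorph0 mul0r.
rewrite big_cons IHs.
under [RHS]eq_bigr do rewrite natrD mulrDl rmorphD mulrDl.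
rewrite big_split /=; congr (_ + _).
rewrite (bigD1 x) //= eqxx mul1r.
rewrite big1 ?addr0 // => i /negPf; rewrite eq_sym => ->.
by rewrite mul0r rmorph0 mul0r.
Qed.

Lemma basis_inj (n : nat) (b : 'I_n -> R) (a a' : 'I_n -> C) :
  module_basis iota b ->
  \sum_i iota (a i) * b i = \sum_i iota (a' i) * b i -> a =1 a'.
Proof.
move=> [_ bfree] /eqP; rewrite -subr_eq0 -sumrB => /eqP sum0 i.
apply/eqP; rewrite -subr_eq0; apply/eqP.
apply: (bfree (index_enum 'I_n) (fun i => a i - a' i)) => //.
- exact: index_enum_uniq.
- by rewrite -[RHS]sum0; apply: eq_bigr => j _; rewrite rmorphB mulrBl.
- exact: mem_index_enum.
Qed.

Definition left_matrix (n : nat) (b : 'I_n -> R) (r : R) (M : 'M[C]_n) :=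
  forall j, r * b j = \sum_i iota (M i j) * b i.

Lemma left_matrix_exists (n : nat) (b : 'I_n -> R) :
  module_basis iota b -> forall r, exists M, left_matrix b r M.
Proof.
move=> bb r; have /choice[a aE] j := basis_coord bb (r * b j).
by exists (\matrix_(i, j) a j i) => j; rewrite aE; apply: eq_bigr => i _; rewrite mxE.
Qed.

Lemma left_matrix_uniq (n : nat) (b : 'I_n -> R) r M M' :
  module_basis iota b -> left_matrix b r M -> left_matrix b r M' -> M = M'.
Proof.
move=> bb rM rM'; apply/matrixP=> i j.
by apply: (basis_inj (a := M ^~ j) (a' := M' ^~ j) bb); rewrite -rM -rM'.
Qed.

Hypothesis iotaC : forall (c : C) (r : R), iota c * r = r * iota c.

Lemma left_matrixM (n : nat) (b : 'I_n -> R) r r' M M' :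
  left_matrix b r M -> left_matrix b r' M' -> left_matrix b (r * r') (M *m M').
Proof.
move=> rM rM' j; rewrite -mulrA rM' mulr_sumr.
under eq_bigr do rewrite mulrA -iotaC -mulrA rM mulr_sumr.
rewrite exchange_big; apply: eq_bigr => i _ /=.
rewrite mxE rmorph_sum mulr_suml; apply: eq_bigr => l _.
by rewrite [M i l * _]mulrC rmorphM mulrA.
Qed.

Lemma left_matrixD (n : nat) (b : 'I_n -> R) a x y M N :
  left_matrix b x M -> left_matrix b y N ->
  left_matrix b (iota a * x + y) (a *: M + N).
Proof.
move=> xM yN j; rewrite mulrDl -mulrA xM yN mulr_sumr -big_split.
by apply: eq_bigr => i _ /=; rewrite !mxE rmorphD rmorphM mulrDl mulrA.
Qed.

Variables (br : C -> C -> C) (d : C -> R -> R).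
Hypothesis dP : poisson_order iota br d.

Lemma regular_trace_order (tr : R -> C) :
  is_regular_trace iota tr -> poisson_trace_order iota br d tr.
Proof.
move=> [n [b [bb trP]]].
have trE r M : left_matrix b r M -> tr r = \tr M.
  by have [M' [rM' ->]] := trP r => rM; rewrite (left_matrix_uniq bb rM rM').
have mxP := left_matrix_exists bb.
split=> //; first split.
- move=> a x y; have [M xM] := mxP x; have [N yN] := mxP y.
  by rewrite (trE _ _ xM) (trE _ _ yN) (trE _ _ (left_matrixD a xM yN)) linearP.
- move=> x y; have [M xM] := mxP x; have [N yN] := mxP y.
  rewrite (trE _ _ (left_matrixM xM yN)) (trE _ _ (left_matrixM yN xM)).
  exact: mxtrace_mulC.
move=> c r; have [M rM] := mxP r.
have [dlin dM] := order_derivation dP c.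
have dD x y : d c (x + y) = d c x + d c y.
  by have:= dlin 1 x y; rewrite !scale1r.
have d0 : d c 0 = 0 by apply: (addIr (d c 0)); rewrite -dD !add0r.
have dsum (F : 'I_n -> R) : d c (\sum_i F i) = \sum_i d c (F i).
  exact: (big_morph (d c) dD d0).
(* [d c] need not be C-linear, so [D] records only its values on the basis; the coefficients
   contribute [map_mx (br c) M] below. *)
have [D DE] : exists D : 'M[C]_n, forall j, d c (b j) = \sum_i iota (D i j) * b i.
  have /choice[a aE] j := basis_coord bb (d c (b j)).
  exists (\matrix_(i, j) a j i) => j; rewrite aE.
  by apply: eq_bigr => i _; rewrite mxE.
(* Differentiating r * b j = sum_i M i j * b i. *)
have drM : left_matrix b (d c r) (map_mx (br c) M + D *m M - M *m D).
  move=> j; apply: (addIr (r * d c (b j))); rewrite -dM rM dsum.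
  under eq_bigr do rewrite dM (order_restrict dP) DE.
  rewrite big_split /= DE mulr_sumr.
  under [X in _ = _ + X]eq_bigr do rewrite mulrA -iotaC -mulrA rM mulr_sumr.
  under [X in _ + X = _]eq_bigr do rewrite mulr_sumr.
  rewrite exchange_big [X in _ = _ + X]exchange_big -!big_split.
  apply: eq_bigr => i _ /=; rewrite !mxE !rmorphB !rmorphD !rmorph_sum.
  rewrite !mulrBl !mulrDl -!addrA; congr (_ + _).
  rewrite !mulr_suml -sumrN -!big_split /=; apply: eq_bigr => l _.
  by rewrite !mulrA -!rmorphM [M l j * _]mulrC [D l j * _]mulrC addNr addr0.
rewrite (trE _ _ drM) (trE _ _ rM) linearB linearD /= mxtrace_mulC addrK.
have brD x y : br c (x + y) = br c x + br c y.
  by have:= bracket_linearr (order_bracket dP) c 1 x y; rewrite !scale1r.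
have br0 : br c 0 = 0 by apply: (addIr (br c 0)); rewrite -brD !add0r.
rewrite /mxtrace (big_morph (br c) brD br0).
by apply: eq_bigr => i _; rewrite mxE.
Qed.

Lemma regular_trace_exists :
  free_module iota -> exists tr : R -> C, is_regular_trace iota tr.
Proof.
move=> /(finite_basis (order_finite dP))[n [b bb]].
have /choice[M rM] := left_matrix_exists bb.
exists (fun r => \tr (M r)), n, b; split=> // r.
by exists (M r); split=> [j|//]; apply: rM.
Qed.

End RegularTrace.

(** * Compatibility of the reduced trace *)

(** Write [delta_mx i j] as [delta_mx i 0 *m delta_mx 0 j]. Swapping the factors gives 0 off the
    diagonal and [delta_mx 0 0] on it, so [f] is determined by its value there. *)
Lemma mxtrace_universal (F : fieldType) (n : nat) (f : 'M[F]_n -> F) :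
  (forall a X Y, f (a *: X + Y) = a * f X + f Y) ->
  (forall X Y, f (X *m Y) = f (Y *m X)) ->
  exists lam, forall X, f X = lam * \tr X.
Proof.
case: n f => [|n] f flin fC.
  have f0 : f 0 = 0.
    by apply: (addIr (f 0)); rewrite -[X in X + _]mul1r -flin scaler0 !add0r.
  by exists 0 => X; rewrite mul0r [X]flatmx0.
have fD X Y : f (X + Y) = f X + f Y by rewrite -[X]scale1r flin mul1r scale1r.
have f0 : f 0 = 0 by apply: (addIr (f 0)); rewrite -fD !add0r.
have fZ a X : f (a *: X) = a * f X by rewrite -[a *: X]addr0 flin f0 addr0.
exists (f (delta_mx 0 0)) => X.
have fdelta i j : f (delta_mx i j) = (i == j)%:R * f (delta_mx 0 0).
  rewrite -(mul_delta_mx (0 : 'I_n.+1)) fC.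
  have [->|ij] := eqVneq i j; rewrite ?mul_delta_mx ?mul1r //.
  by rewrite mul_delta_mx_0 ?f0 ?mul0r // eq_sym.
rewrite [in LHS](matrix_sum_delta X) (big_morph f fD f0) /mxtrace mulr_sumr.
apply: eq_bigr => i _; rewrite (big_morph f fD f0) (bigD1 i) //= big1 => [|j ji].
  by rewrite addr0 fZ fdelta eqxx mul1r mulrC.
by rewrite fZ fdelta eq_sym (negPf ji) mul0r mulr0.
Qed.

(* The reason is det ('X^p - A^p) = det (('X - A)^p) = det ('X - A)^p. *)
Lemma char_poly_Frobenius (F : fieldType) (p n : nat) (A : 'M[F]_n.+1) :
  p \in [pchar F] -> char_poly (A ^+ p) \Po 'X^p = char_poly A ^+ p.
Proof.
move=> pF.
have pM : p \in [pchar 'M[{poly F}]_n.+1].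
  apply: (rmorph_pchar (@scalar_mx {poly F} n.+1)).
  exact: (rmorph_pchar (@polyC F)).
transitivity (\det (char_poly_mx A ^+ p)); last first.
  elim: (p) => [|m IHm]; first by rewrite !expr0 det1.
  by rewrite !exprS det_mulmx IHm.
rewrite -(pFrobenius_autE pM) /char_poly_mx pFrobenius_autB_comm; last first.
  exact: comm_scalar_mx.
rewrite !pFrobenius_autE.
have -> : 'X%:M ^+ p = ('X^p)%:M :> 'M[{poly F}]_n.+1 by rewrite -rmorphXn.
have -> : map_mx polyC A ^+ p = map_mx polyC (A ^+ p) by rewrite -rmorphXn.
have -> : ('X^p)%:M - map_mx polyC (A ^+ p) =
    map_mx (comp_poly 'X^p) (char_poly_mx (A ^+ p)).
  by apply/matrixP=> i j; rewrite !mxE linearB /= comp_polyC rmorphMn /= comp_polyX.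
by rewrite det_map_mx.
Qed.

(** Frobenius is additive on polynomials: it raises the coefficients to the power p and multiplies
    the degrees by p. *)
Lemma coef_poly_Frobenius (F : fieldType) (p : nat) (P : {poly F}) i :
  p \in [pchar F] -> (P ^+ p)`_(i * p) = P`_i ^+ p.
Proof.
move=> pF; have p_gt0 := prime_gt0 (pcharf_prime pF).
have pP : p \in [pchar {poly F}] by apply: (rmorph_pchar (@polyC F)).
rewrite -(pFrobenius_autE pP) -[P in LHS]coefK poly_def raddf_sum /=.
under eq_bigr do rewrite -mul_polyC rmorphM /= !pFrobenius_autE -polyC_exp -exprM mul_polyC.
rewrite coef_sumMXn; have [iP|Pi] := ltnP i (size P).
  rewrite (big_pred1 (Ordinal iP)) // => j.
  by rewrite /= eqn_pmul2r // -val_eqE.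
rewrite big_pred0 ?nth_default ?expr0n ?gtn_eqF // => j.
by rewrite eqn_pmul2r // ltn_eqF // (leq_trans _ Pi).
Qed.

(** For size [n.+1], compare the coefficients of degree [n * p] in [char_poly_Frobenius]: minus the
    trace of [A ^+ p], and the p-th power of minus the trace of [A]. *)
Lemma mxtrace_Frobenius (F : fieldType) (p n : nat) (A : 'M[F]_n) :
  p \in [pchar F] -> \tr (A ^+ p) = \tr A ^+ p.
Proof.
move=> pF; have p_gt0 := prime_gt0 (pcharf_prime pF).
case: n A => [|n] A; first by rewrite /mxtrace !big_ord0 expr0n gtn_eqF.
have := congr1 (fun P : {poly F} => P`_(n * p)) (char_poly_Frobenius A pF).
rewrite coef_poly_Frobenius // coef_comp_poly_Xn // dvdn_mull // mulnK //.
rewrite -[n]/(n.+1.-1) !char_poly_trace // => /(congr1 -%R).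
by rewrite opprK -(pFrobenius_autE pF) pFrobenius_autN opprK pFrobenius_autE.
Qed.

(** Both maps factor the same balanced map, so uniqueness in the universal property applies. They
    are bare functions so that anonymous functions can be supplied. *)
Lemma tensor_product_ext (S : Type) (M N T V : zmodType)
    (smulM : S -> M -> M) (smulN : S -> N -> N) (t : M -> N -> T)
    (h h' : T -> V) :
  is_tensor_product smulM smulN t -> zmod_morphism h -> zmod_morphism h' ->
  (forall x y, h (t x y) = h' (t x y)) -> h =1 h'.
Proof.
move=> [[tDl tDr tS] tU] hB h'B hh'.
pose H : {additive T -> V} :=
  HB.pack h (GRing.isZmodMorphism.Build T V h hB).
pose H' : {additive T -> V} :=
  HB.pack h' (GRing.isZmodMorphism.Build T V h' h'B).
have [g [_ gU]] := tU V (fun x y => h (t x y)) (And3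
  (fun x x' y => etrans (congr1 H (tDl x x' y)) (raddfD H _ _))
  (fun x y y' => etrans (congr1 H (tDr x y y')) (raddfD H _ _))
  (fun s x y => congr1 H (tS s x y))).
by move=> x; rewrite -[h x]/(H x) -[h' x]/(H' x) !gU // => a b; exact/esym/hh'.
Qed.

Section ReducedTrace.
Variables (k : comNzRingType) (R : algType k) (C : comAlgType k).
Variables (iota : {lrmorphism C -> R}) (Q : fieldType) (q : {rmorphism C -> Q}).
Variables (F : fieldExtType Q) (n : nat) (phi : {rmorphism R -> 'M[F]_n}).
Hypothesis phiP : splitting iota q phi.

Lemma splitting_scale c r : phi (iota c * r) = (q c)%:A *: phi r.
Proof. by have [[_ _ /(_ c r 1)]] := phiP; rewrite scale1r. Qed.

(** The universal property extends [th] to an F-linear form on all matrices. It is again symmetric,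
    by reduction to pure tensors in each argument, so [mxtrace_universal] applies. *)
Lemma splitting_trace_universal (th : R -> F) :
  {morph th : x y / x + y} -> (forall c x, th (iota c * x) = q c *: th x) ->
  (forall x y, th (x * y) = th (y * x)) ->
  exists lam, forall r, th r = lam * \tr (phi r).
Proof.
move=> thD thZ thC; have [tB tU] := phiP.
have [|g [gE _]] := tU F (fun r x => x * th r).
  split=> [r r' x|r x x'|c r x]; first by rewrite thD mulrDr.
    by rewrite mulrDl.
  by rewrite thZ -scalerAr scalerAl.
have ext := tensor_product_ext phiP.
have gZ a X : g (a *: X) = a * g X.
  apply: (ext _ (fun X => g (a *: X)) (fun X => a * g X)) X.
  - by move=> X Y; rewrite scalerBr raddfB.
  - by move=> X Y; rewrite raddfB mulrBr.
  by move=> r x; rewrite scalerA !gE mulrA.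
have gC X Y : g (X *m Y) = g (Y *m X).
  apply: (ext _ (fun X => g (X *m Y)) (fun X => g (Y *m X))) X.
  - by move=> X X'; rewrite mulmxBl raddfB.
  - by move=> X X'; rewrite mulmxBr raddfB.
  move=> r x; apply: (ext _ (fun Y => g ((x *: phi r) *m Y))
                            (fun Y => g (Y *m (x *: phi r)))) Y.
  - by move=> Y Y'; rewrite mulmxBr raddfB.
  - by move=> Y Y'; rewrite mulmxBl raddfB.
  move=> s y; rewrite -!scalemxAl -!scalemxAr !gZ mulrCA.
  rewrite -[phi r *m _]/(phi r * phi s) -[phi s *m _]/(phi s * phi r).
  rewrite -!rmorphM -[phi (r * s)]scale1r -[phi (s * r)]scale1r !gE.
  by rewrite thC.
have [a X Y||lam lamP] := @mxtrace_universal F n g _ _ => //.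
  by rewrite raddfD gZ.
by exists lam => r; rewrite -lamP -[phi r]scale1r gE mul1r.
Qed.

Hypothesis qI : injective q.
Variable tr : R -> C.
Hypothesis trP : forall r, (q (tr r))%:A = \tr (phi r) :> F.

Let qF c := (q c)%:A : F.
Let qFI : injective qF.
Proof. by move=> x y /(fmorph_inj (in_alg F))/qI. Qed.

Lemma reduced_trace_map : trace_map iota tr.
Proof.
split=> [a x y|x y]; apply: qFI.
  rewrite /qF trP rmorphD splitting_scale linearP /= -!trP rmorphD rmorphM /=.
  by rewrite scalerDl mulr_algl -scalerA.
by rewrite /qF !trP !rmorphM mxtrace_mulC.
Qed.

Variables (br : C -> C -> C) (d : C -> R -> R).
Hypothesis dP : poisson_order iota br d.

Lemma reduced_trace_order : poisson_trace_order iota br d tr.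
Proof.
have [trlin trC] := reduced_trace_map.
split=> // c.
have [dlin dM] := order_derivation dP c.
have brP := order_bracket dP.
have dD x y : d c (x + y) = d c x + d c y.
  by have:= dlin 1 x y; rewrite !scale1r.
have trD x y : tr (x + y) = tr x + tr y.
  by have:= trlin 1 x y; rewrite rmorph1 !mul1r.
have tr0 : tr 0 = 0 by apply: (addIr (tr 0)); rewrite -trD !add0r.
have trZ a x : tr (iota a * x) = a * tr x.
  by have:= trlin a x 0; rewrite tr0 !addr0.
have brD x y : br c (x + y) = br c x + br c y.
  by have:= bracket_linearr brP c 1 x y; rewrite !scale1r.
have brM := bracket_leibniz brP c.
have d1 : d c 1 = 0.
  apply: (addIr (d c 1)).
  by rewrite -{1}(mulr1 (d c 1)) -{2}(mul1r (d c 1)) -dM mulr1 add0r.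
have br1 : br c 1 = 0.
  apply: (addIr (br c 1)).
  by rewrite -{1}(mulr1 (br c 1)) -{2}(mul1r (br c 1)) -brM mulr1 add0r.
have br0 : br c 0 = 0 by apply: (addIr (br c 0)); rewrite -brD !add0r.
pose th r := qF (tr (d c r)) - qF (br c (tr r)).
have qFD x y : qF (x + y) = qF x + qF y by rewrite /qF rmorphD scalerDl.
have qFM x y : qF (x * y) = qF x * qF y.
  by rewrite /qF rmorphM mulr_algl scalerA.
have [|||lam lamP] := @splitting_trace_universal th.
- by move=> x y; rewrite /th dD !trD brD !qFD opprD addrACA.
(* The terms [br c a * tr x] coming from the two Leibniz rules cancel. *)
- move=> a x; rewrite /th dM (order_restrict dP) trD !trZ brM !qFD !qFM.
  by rewrite opprD addrACA subrr add0r -mulrBr /qF mulr_algl.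
- move=> x y; rewrite /th [tr (x * y)]trC !dM !trD.
  by rewrite [tr (d c x * y)]trC [tr (d c y * x)]trC [tr (y * d c x) + _]addrC.
suff th0 r : th r = 0.
  by move=> r; apply: qFI; apply/eqP; rewrite -subr_eq0; apply/eqP/th0.
have brn m : br c m%:R = 0.
  by elim: m => [|m IHm]; rewrite // -addn1 natrD brD IHm br1 addr0.
have tr1 : tr 1 = n%:R.
  by apply: qFI; rewrite /qF trP rmorph1 mxtrace1 rmorph_nat scaler_nat.
have th1 : th 1 = 0 by rewrite /th d1 tr1 brn tr0 subrr.
rewrite lamP; have [nF|nF] := eqVneq (n%:R : F) 0; last first.
  move: (lamP 1); rewrite th1 rmorph1 mxtrace1 => /esym/eqP.
  by rewrite mulf_eq0 (negPf nF) orbF => /eqP ->; rewrite mul0r.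
have [n0|n_gt0] := posnP n.
  rewrite /mxtrace big1 ?mulr0 // => i _.
  by have := ltn_ord i; rewrite {2}n0.
have [p pF] := natf0_pchar n_gt0 (introT eqP nF).
have p0C : p%:R = 0 :> C.
  apply: qFI; rewrite /qF rmorph_nat scaler_nat rmorph0 scale0r.
  exact: pcharf0 pF.
have brX a m : br c (a ^+ m) = m%:R * (a ^+ m.-1 * br c a).
  elim: m => [|m IHm]; first by rewrite expr0 br1 mul0r.
  rewrite exprS brM IHm -[in RHS]natr1 mulrDl mul1r addrC /=; congr (_ + _).
    case: (m) => [|m']; first by rewrite !mul0r mulr0.
    by rewrite mulrCA exprS -[a * _ * _]mulrA.
  by rewrite mulrC.
(* Cyclicity of the trace gathers the powers of [x]. The exponent [j] is there for the induction; at
   m = 0 the truncated [m.-1] is harmless, as its factor is 0. *)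
have trdX x m j : tr (x ^+ j * d c (x ^+ m)) = m%:R * tr (x ^+ (j + m.-1) * d c x).
  elim: m j => [|m IHm] j; first by rewrite expr0 d1 mulr0 tr0 mul0r.
  rewrite exprS dM mulrDr trD [x ^+ j * (x * _)]mulrA -exprSr IHm /=.
  rewrite -[in RHS]natr1 mulrDl mul1r.
  rewrite addrC; congr (_ + _).
    by case: (m) => [|m']; rewrite ?mul0r // addSnnS.
  by rewrite mulrA trC mulrA -exprD addnC.
have thX : th (r ^+ p) = 0.
  rewrite /th; have := trdX r p 0%N; rewrite expr0 mul1r p0C mul0r => ->.
  suff -> : tr (r ^+ p) = tr r ^+ p by rewrite brX p0C mul0r subrr.
  apply: qFI; rewrite /qF trP rmorphXn mxtrace_Frobenius // -trP -in_algE.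
  by rewrite -!rmorphXn.
(* Now [lam] times the p-th power of the trace of [phi r] is 0, so one of the two factors
   vanishes. *)
move: thX; rewrite lamP rmorphXn mxtrace_Frobenius // => /eqP.
rewrite mulf_eq0 expf_eq0 => /orP[/eqP ->|/andP[_ /eqP ->]]; first by rewrite mul0r.
by rewrite mulr0.
Qed.

End ReducedTrace.

(** * Prime algebras of finite dimension *)

Section PrimeAlgebra.
Variables (Q : fieldType) (A : falgType Q).
Hypothesis A_prime : prime_ring A.

(** Induction on the dimension. Primeness yields [a] in [U] with [a U] nonzero. If [a U] is smaller
    than [U], induct. Otherwise left multiplication by [a] is bijective on [U], and the [e] in [U]
    with [a * e = a] is idempotent because [a * (e * e - e) = 0]. *)
Lemma right_ideal_idempotent (U : {vspace A}) :
  U != 0%VS -> (forall u x, u \in U -> u * x \in U) ->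
  exists e, [/\ e \in U, e != 0 & e * e = e].
Proof.
have [m] := ubnP (\dim U); elim: m U => // m IHm U dimU U_neq0 U_ideal.
have [u uU u_neq0] : exists2 u, u \in U & u != 0.
  by exists (vpick U); rewrite ?memv_pick // vpick0.
have [x uxu] : exists x, u * x * u != 0.
  apply: contrapT => /forallNP uxu.
  have /A_prime[] : forall x, u * x * u = 0 => [x|u0|u0]; last 2 first.
  - by rewrite u0 eqxx in u_neq0.
  - by rewrite u0 eqxx in u_neq0.
  by apply/eqP; apply: contrapT => /negP/(uxu x).
pose a := u * x; have aU : a \in U by apply: U_ideal.
pose W := (amull a @: U)%VS.
have WU : (W <= U)%VS.
  by apply/subvP => _ /memv_imgP[v _ ->]; rewrite lfunE; apply: U_ideal.
have W_neq0 : W != 0%VS.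
  have : amull a u \in W by rewrite memv_img.
  by apply: contraTneq => ->; rewrite memv0 lfunE.
have W_ideal w y : w \in W -> w * y \in W.
  move=> /memv_imgP[v vU ->]; apply/memv_imgP; exists (v * y).
    exact: U_ideal.
  by rewrite !lfunE /= mulrA.
have [dimW|dimW] := ltnP (\dim W) (\dim U).
  have [|e [eW e0 ee]] := IHm W _ W_neq0 W_ideal.
    by rewrite (leq_trans dimW).
  by exists e; split=> //; apply: (subvP WU).
have WE : W = U by apply/eqP; rewrite -(geq_leqif (dimv_leqif_eq WU)).
have kerU : (U :&: lker (amull a) = 0)%VS.
  apply/eqP; rewrite -dimv_eq0 -(eqn_add2r (\dim W)) add0n limg_ker_dim.
  by rewrite WE.
have /memv_imgP[e eU] : a \in W by rewrite WE.
rewrite lfunE /= => ae.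
have a_neq0 : a != 0 by apply: contraNneq uxu => a0; rewrite -/a a0 mul0r.
exists e; split=> //.
  by apply: contraNneq a_neq0 => e0; rewrite ae e0 mulr0.
apply/eqP; rewrite -subr_eq0 -memv0 -kerU memv_cap rpredB ?U_ideal //=.
by rewrite memv_ker lfunE /= mulrBr mulrA -!ae subrr.
Qed.

(** Start from the idempotent 0 and shrink the right annihilator [r e]. As long as [e] is not 1, a
    nonzero idempotent [f] in [r e :&: I] makes [e + f - f * e] an idempotent of [I] with a strictly
    smaller annihilator. *)
Lemma ideal_contains1 (I : {vspace A}) :
  I != 0%VS -> (forall u x, u \in I -> u * x \in I) ->
  (forall u x, u \in I -> x * u \in I) -> 1 \in I.
Proof.
move=> I_neq0 Ir Il.
pose r (e : A) := lker (amull e).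
suff Hr m : forall e, (\dim (r e) < m)%N -> e \in I -> e * e = e -> 1 \in I.
  by apply: (Hr _ 0 (ltnSn _)); rewrite ?mem0v ?mulr0.
elim: m => // m IHm e dim_r eI ee.
have [->//|e_neq1] := eqVneq 1 e.
pose U := (r e :&: I)%VS.
have rE x : (x \in r e) = (e * x == 0) by rewrite memv_ker lfunE.
have [|u x|f [fU f_neq0 ff]] := @right_ideal_idempotent U.
(* If [U] were 0, then [1 - e] would annihilate [I] from the left, against primeness. *)
- apply/negP => /eqP U0.
  have vI : forall i, i \in I -> (1 - e) * i = 0.
    move=> i iI; apply/eqP; rewrite -memv0 -U0 memv_cap Il // andbT rE.
    by rewrite mulrA mulrBr mulr1 ee subrr mul0r.
  have [|e1|i0] := @A_prime (1 - e) (vpick I).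
  + by move=> x; rewrite -mulrA vI // Il // memv_pick.
  + by move/eqP: e1; rewrite subr_eq0 (negPf e_neq1).
  + by move/eqP: i0; rewrite vpick0 (negPf I_neq0).
- by rewrite !memv_cap !rE => /andP[/eqP eu uI]; rewrite mulrA eu mul0r eqxx Ir.
move: fU; rewrite memv_cap rE => /andP[/eqP ef fI].
have ee' : e * (e + f - f * e) = e.
  by rewrite mulrBr mulrDr ee ef mulrA ef mul0r addr0 subr0.
apply: (IHm (e + f - f * e)).
(* The inclusion of annihilators is strict: [e * f = 0], while the new idempotent times [f] is
   [f]. *)
- rewrite -ltnS; apply: leq_trans dim_r; rewrite ltnS ltnNge; apply/negP => dim_le.
  have sub : (r (e + f - f * e) <= r e)%VS.
    apply/subvP => x; rewrite rE memv_ker lfunE /= => /eqP e'x.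
    by rewrite -ee' -mulrA e'x mulr0.
  have : f \in r (e + f - f * e).
    have -> : r (e + f - f * e) = r e.
      by apply/eqP; rewrite -(geq_leqif (dimv_leqif_eq sub)).
    by rewrite rE ef.
  by rewrite memv_ker lfunE /= mulrBl mulrDl ef ff -mulrA ef mulr0 add0r subr0 (negPf f_neq0).
- by rewrite rpredB ?rpredD ?Ir.
rewrite [in LHS]mulrBl mulrDl ee'.
have -> : f * (e + f - f * e) = f by rewrite mulrBr mulrDr mulrA ff addrAC subrr add0r.
by rewrite -mulrA ee'.
Qed.

(* Elements of the multiplication algebra of A are coded by lists of pairs. *)
Definition mult_op (s : seq (A * A)) (a : A) : A := \sum_(t <- s) t.1 * a * t.2.

Lemma prodv_ind (U V : {vspace A}) (P : A -> Prop) :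
  P 0 -> (forall x y, P x -> P y -> P (x + y)) ->
  (forall u v, u \in U -> v \in V -> P (u * v)) ->
  forall x, x \in (U * V)%VS -> P x.
Proof.
move=> P0 PD PM x; rewrite unlock => /coord_span ->.
elim/big_rec: _ => // i y _; apply: PD.
set X := allpairs_tuple _ _ _.
have /allpairsP[[u v] /= [Uu Vv ->]] : X`_i \in allpairs *%R (vbasis U) (vbasis V).
  by apply: mem_nth; rewrite size_tuple.
by rewrite scalerAl; apply: PM; rewrite ?memvZ ?(vbasis_mem Uu) ?(vbasis_mem Vv).
Qed.

(** The two-sided ideal generated by [a] contains 1 by [ideal_contains1], and its elements are
    values at [a] of coded operators. *)
Lemma mult_op_simple a : a != 0 -> exists s, mult_op s a = 1.
Proof.
move=> a_neq0.
pose I := (fullv * <[a]> * fullv)%VS.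
have aI : a \in I.
  by rewrite -[a]mul1r -[1 * a]mulr1 !memv_mul ?memvf ?memv_line.
have : 1 \in I.
  apply: ideal_contains1.
  - by apply: contraTneq aI => ->; rewrite memv0.
  - move=> u x uI; have : u * x \in (I * fullv)%VS by rewrite memv_mul ?memvf.
    by apply/subvP; rewrite /I -prodvA prodvSr // subvf.
  - move=> u x uI; have : x * u \in (fullv * I)%VS by rewrite memv_mul ?memvf.
    by apply/subvP; rewrite /I !prodvA !prodvSl // subvf.
apply: (prodv_ind (P := fun x => exists s, mult_op s a = x)) => [|x y [s <-] [t <-]|u v uI _].
- by exists [::]; rewrite /mult_op big_nil.
- by exists (s ++ t); rewrite /mult_op big_cat.
have /memv_cosetP[y _ ->] := uI.
by exists [:: (y, v)]; rewrite /mult_op big_seq1.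
Qed.

Hypothesis A_central : forall z : A, (forall x, x * z = z * x) -> exists a, z = a%:A.

Lemma mult_opD s t a : mult_op (s ++ t) a = mult_op s a + mult_op t a.
Proof. by rewrite /mult_op big_cat. Qed.

Lemma mult_op_linear s : linear (mult_op s).
Proof.
move=> a x y; rewrite /mult_op scaler_sumr -big_split; apply: eq_bigr => t _ /=.
by rewrite mulrDr mulrDl scalerAl scalerAr.
Qed.

Lemma mult_op_span s (es : seq A) :
  (forall x, x \in es -> mult_op s x = 0) ->
  forall x, x \in <<es>>%VS -> mult_op s x = 0.
Proof.
move=> ses x /(@coord_span _ _ _ (in_tuple es)) ->.
elim/big_rec: _ => [|i y _ sy].
  by rewrite /mult_op big1 // => t _; rewrite mulr0 mul0r.
by rewrite mult_op_linear sy addr0 ses ?scaler0 // mem_nth // size_tuple.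
Qed.

Definition mult_op_comp y z s : seq (A * A) := [seq (y * t.1, t.2 * z) | t <- s].

Lemma mult_op_compE y z s a : mult_op (mult_op_comp y z s) a = y * mult_op s a * z.
Proof.
rewrite /mult_op big_map mulr_sumr mulr_suml.
by apply: eq_bigr => t _ /=; rewrite !mulrA.
Qed.

Lemma mult_op_seq s t : exists u, forall a, mult_op u a = mult_op s (mult_op t a).
Proof.
exists (flatten [seq mult_op_comp y.1 y.2 t | y <- s]) => a.
elim: s => [|y s IHs]; first by rewrite /mult_op !big_nil.
by rewrite /= mult_opD IHs mult_op_compE [in RHS]/mult_op big_cons.
Qed.

(* Density of the multiplication algebra, since the A-bimodule A is simple with
   endomorphism ring Q. *)
Lemma mult_op_separate (es : seq A) e : e \notin <<es>>%VS ->
  exists s, mult_op s e = 1 /\ forall x, x \in es -> mult_op s x = 0.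
Proof.
(* A further operator moves a nonzero value to 1 and preserves the vanishing on [es]. *)
suff sep es' e' : e' \notin <<es'>>%VS ->
    exists s, mult_op s e' != 0 /\ forall x, x \in es' -> mult_op s x = 0.
  move=> /sep[s [/mult_op_simple[t te] ses]]; have [u uE] := mult_op_seq t s.
  exists u; split=> [|x /ses sx]; first by rewrite uE.
  by rewrite uE sx /mult_op big1 // => y _; rewrite mulr0 mul0r.
elim: es' e' => {es e} [|f es IHes] e.
  rewrite span_nil memv0 => e0; exists [:: (1, 1)]; split=> //.
  by rewrite /mult_op big_seq1 mul1r mulr1.
rewrite span_cons => eNfes.
have [f_es|f_es] := boolP (f \in <<es>>%VS).
  have [|s [se ses]] := IHes e.
    by apply: contra eNfes; apply/subvP/addvSr.
  by exists s; split=> // x; rewrite inE => /predU1P[->|/ses //]; apply: mult_op_span f_es.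
have [s0 [/mult_op_simple[t tf] s0es]] := IHes f f_es.
have [s sE] := mult_op_seq t s0.
have sf : mult_op s f = 1 by rewrite sE.
have ses x : x \in es -> mult_op s x = 0.
  by move=> /s0es s0x; rewrite sE s0x /mult_op big1 // => y _; rewrite mulr0 mul0r.
pose w := mult_op s e.
(* If [w] does not commute with [x], follow [s] by the commutator with [x]: this kills [es], and [f]
   since [s] sends it to 1, but not [e]. *)
have [[x xw]|wC] := pselect (exists x, x * w != w * x).
  exists (mult_op_comp x 1 s ++ mult_op_comp (- 1) x s); split=> [|y].
    by rewrite mult_opD !mult_op_compE mulr1 mulN1r mulNr subr_eq0.
  rewrite mult_opD !mult_op_compE mulr1 mulN1r mulNr inE.
  by move=> /predU1P[->|/ses ->]; rewrite ?sf ?mulr1 ?mul1r ?subrr ?mulr0 ?oppr0 ?mul0r ?subr0.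
have [x|lam wE] := A_central (z := w).
  by apply/eqP; apply: contrapT => /negP xw; apply: wC; exists x.
have eNes : e - lam *: f \notin <<es>>%VS.
  apply: contra eNfes => efes; apply/memv_addP.
  exists (lam *: f); first by rewrite memvZ ?memv_line.
  by exists (e - lam *: f); rewrite // addrC subrK.
have [t' [t'e t'es]] := IHes _ eNes.
(* The correction by [s] kills [f]; at [e] the result is the value of [t'] at [e - lam *: f], which
   is nonzero. *)
exists (t' ++ mult_op_comp (- mult_op t' f) 1 s); split=> [|y].
  have := t'e; rewrite [e - _]addrC -scaleNr mult_op_linear scaleNr addrC.
  by rewrite mult_opD mult_op_compE -/w wE mulr1 -scalerAr mulr1 scalerN.
rewrite mult_opD mult_op_compE mulr1 inE => /predU1P[->|yes].
  by rewrite sf mulr1 subrr.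
by rewrite t'es // ses // mulr0 addr0.
Qed.

End PrimeAlgebra.

(** * Representations over finite extensions *)

Lemma ex_min_nat (P : nat -> Prop) :
  (exists n, P n) -> exists2 n, P n & forall m, P m -> (n <= m)%N.
Proof.
move=> [n0 Pn0]; have exP : exists n, `[< P n >] by exists n0; apply/asboolP.
by exists (ex_minn exP); case: ex_minnP => n /asboolP Pn nP // m Pm; apply/nP/asboolP.
Qed.

Lemma irreducible_divisor (F : fieldType) (p : {poly F}) :
  (1 < size p)%N -> exists2 d, irreducible_poly d & d %| p.
Proof.
have [m] := ubnP (size p); elim: m p => // m IHm p sz_p p_gt1.
have [irr_p|] := pselect (irreducible_poly p); first by exists p.
move=> /not_andP[/(_ p_gt1)//|/existsNP[d]].
move=> /not_implyP[d_neq1] /not_implyP[dp ndp].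
have p_neq0 : p != 0 by rewrite -size_poly_gt0 ltnW.
have d_lt : (size d < size p)%N.
  by rewrite ltn_neqAle (dvdp_leq p_neq0 dp) andbT dvdp_size_eqp //; apply/negP.
have d_gt1 : (1 < size d)%N.
  by rewrite ltn_neqAle eq_sym d_neq1 size_poly_gt0 (dvdpN0 dp).
have [||e irr_e ed] := IHm d => //; first by rewrite (leq_trans d_lt).
by exists e => //; apply: dvdp_trans dp.
Qed.

(** Adjoin to F a root of an irreducible factor and view the result as an extension of Q.
    Compatibility with the scalars of Q allows representations to be carried along [f]. *)
Lemma finite_extension_root (Q : fieldType) (F : fieldExtType Q) (p : {poly F}) :
  (1 < size p)%N ->
  exists (F' : fieldExtType Q) (f : {rmorphism F -> F'}),
    (forall a : Q, f a%:A = a%:A) /\ exists z, root (map_poly f p) z.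
Proof.
move=> /irreducible_divisor[d irr_d dp].
have [L _ [z z_root _]] := irredp_FAdjoin irr_d.
exists (baseFieldType L), (in_alg L); split=> [a|].
  by rewrite baseField_scaleE.
by exists z; apply: (root_dvdp _ z_root); rewrite dvdp_map.
Qed.

Section Representations.
Variables (Q : fieldType) (A : falgType Q).

Record alg_rep (F : fieldExtType Q) (m : nat) (rho : A -> 'M[F]_m) : Prop :=
  AlgRep {
    rep_linear : forall a x y, rho (a *: x + y) = a%:A *: rho x + rho y;
    rep1 : rho 1 = 1%:M;
    repM : forall x y, rho (x * y) = rho x *m rho y
  }.

Definition left_mx (x : A) : 'M[Q]_(\dim {:A}) :=
  \matrix_(i, j) coord (vbasis {:A}) i (x * (vbasis {:A})`_j).

Lemma left_mxE (x : A) (j : 'I_(\dim {:A})) :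
  x * (vbasis {:A})`_j = \sum_i left_mx x i j *: (vbasis {:A})`_i.
Proof.
rewrite [LHS](coord_vbasis (memvf _)).
by apply: eq_bigr => i _; rewrite mxE.
Qed.

Lemma left_mx_linear : linear left_mx.
Proof.
move=> a x y; apply/matrixP=> i j.
by rewrite !mxE mulrDl -scalerAl linearP.
Qed.

Lemma left_mx1 : left_mx 1 = 1%:M.
Proof.
apply/matrixP=> i j; rewrite !mxE mul1r coord_free 1?eq_sym //.
exact: (basis_free (vbasisP _)).
Qed.

Lemma left_mxM x y : left_mx (x * y) = left_mx x *m left_mx y.
Proof.
apply/matrixP=> i j; rewrite !mxE -mulrA left_mxE mulr_sumr linear_sum.
by apply: eq_bigr => l _; rewrite -scalerAr linearZ /= [left_mx x _ _]mxE mulrC.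
Qed.

Lemma regular_rep : alg_rep (F := Q^o) (m := \dim {:A}) left_mx.
Proof.
split; [|exact: left_mx1|exact: left_mxM] => a x y.
by rewrite left_mx_linear -[a%:A]/(a * 1) mulr1.
Qed.

Section Span.
Variables (F : fieldExtType Q) (m : nat) (rho : A -> 'M[F]_m).
Hypothesis rhoP : alg_rep rho.

Lemma rep0 : rho 0 = 0.
Proof.
have := rep_linear rhoP 1 0 0; rewrite scaler0 addr0 !scale1r => rho0.
by apply: (addIr (rho 0)); rewrite -rho0 add0r.
Qed.

Lemma rep_coord x :
  rho x = \sum_i (coord (vbasis {:A}) i x)%:A *: rho (vbasis {:A})`_i.
Proof.
rewrite [in LHS](coord_vbasis (memvf x)); elim/big_rec2: _ => [|i X y _ <-].
  exact: rep0.
exact: rep_linear.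
Qed.

Definition rspan (T : 'M[F]_m) := exists s : seq (F * A),
  T = \sum_(p <- s) p.1 *: rho p.2.

Lemma rspan_rep x : rspan (rho x).
Proof. by exists [:: (1, x)]; rewrite big_seq1 scale1r. Qed.

Lemma rspanD S T : rspan S -> rspan T -> rspan (S + T).
Proof. by move=> [s ->] [t ->]; exists (s ++ t); rewrite big_cat. Qed.

Lemma rspanZ a T : rspan T -> rspan (a *: T).
Proof.
move=> [t ->]; exists [seq (a * p.1, p.2) | p <- t].
by rewrite big_map scaler_sumr; apply: eq_bigr => p _; rewrite scalerA.
Qed.

Lemma rspan_sum (I : finType) (T : I -> 'M[F]_m) :
  (forall i, rspan (T i)) -> rspan (\sum_i T i).
Proof.
move=> TP; elim/big_rec: _ => [|i S _]; first by exists [::]; rewrite big_nil.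
exact: rspanD.
Qed.

Lemma rspanM S T : rspan S -> rspan T -> rspan (S *m T).
Proof.
move=> [s ->] [t ->]; rewrite mulmx_suml.
elim: s => [|p s IHs]; first by exists [::]; rewrite !big_nil.
rewrite big_cons; apply: rspanD IHs; rewrite mulmx_sumr.
exists [seq (p.1 * p'.1, p.2 * p'.2) | p' <- t]; rewrite big_map.
by apply: eq_bigr => p' _; rewrite repM // -scalemxAl -scalemxAr scalerA.
Qed.

Lemma rspan_basis T : rspan T ->
  exists x : 'I_(\dim {:A}) -> F, T = \sum_i x i *: rho (vbasis {:A})`_i.
Proof.
move=> [s ->]; exists (fun i => \sum_(p <- s) p.1 * (coord (vbasis {:A}) i p.2)%:A).
under [RHS]eq_bigr do rewrite scaler_suml.
rewrite exchange_big; apply: eq_bigr => p _ /=.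
by rewrite rep_coord scaler_sumr; apply: eq_bigr => i _; rewrite scalerA.
Qed.

End Span.
End Representations.

(** * Representations of minimal degree and Burnside's theorem *)

Section MinimalRepresentation.
Variables (Q : fieldType) (A : falgType Q).

Section Transitivity.
Variables (F : fieldExtType Q) (m : nat) (rho : A -> 'M[F]_m).
Hypothesis rhoP : alg_rep rho.
Hypothesis m_min : forall (k : nat) (rho' : A -> 'M[F]_k),
  alg_rep rho' -> (0 < k)%N -> (m <= k)%N.

(** The rows [v *m rho x] span a nonzero stable space, on which [rho] restricts to a representation
    whose degree is its dimension; by minimality of [m] it is the whole space. *)
Lemma min_rep_row_transitive (v w : 'rV[F]_m) :
  v != 0 -> exists2 X, rspan rho X & v *m X = w.
Proof.
move=> v_neq0; pose e := vbasis {:A}.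
pose U := \matrix_i (v *m rho e`_i) : 'M[F]_(\dim {:A}, m).
have vU x : (v *m rho x <= U)%MS.
  rewrite (rep_coord rhoP) mulmx_sumr summx_sub // => i _.
  rewrite -scalemxAr scalemx_sub //.
  by rewrite -[X in (X <= _)%MS](rowK (fun i => v *m rho e`_i)) row_sub.
have U_stable x : (U *m rho x <= U)%MS.
  apply/row_subP => i; rewrite row_mul rowK -mulmxA -(repM rhoP).
  exact: vU.
have [B B_free BU] : exists2 B : 'M_(\rank U, m), row_free B & (B :=: U)%MS.
  by exists (row_base U); [exact: row_base_free | exact: eq_row_base].
have B_stable x : (B *m rho x <= B)%MS.
  rewrite BU; apply: submx_trans (U_stable x).
  by rewrite submxMr // BU.
have [rho' rho'B] : exists rho' : A -> 'M_(\rank U),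
    forall x, rho' x *m B = B *m rho x.
  by exists (fun x => B *m rho x *m pinvmx B) => x; rewrite mulmxKpV.
have rho'P : alg_rep rho'.
  split=> [a x y||x y]; apply: (row_free_inj B_free).
  - by rewrite mulmxDl -scalemxAl !rho'B (rep_linear rhoP) mulmxDr -scalemxAr.
  - by rewrite rho'B (rep1 rhoP) mulmx1 mul1mx.
  - by rewrite /= rho'B (repM rhoP) -[RHS]mulmxA rho'B !mulmxA rho'B.
have U_neq0 : (0 < \rank U)%N.
  rewrite lt0n mxrank_eq0; apply: contra v_neq0 => /eqP U0.
  by have := vU 1; rewrite (rep1 rhoP) mulmx1 => /submxP[D ->]; rewrite U0 mulmx0.
have U_full : row_full U.
  by rewrite /row_full eqn_leq rank_leq_col (m_min rho'P).
have [D wE] := submxP (submx_full w U_full).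
exists (\sum_i D 0 i *: rho e`_i).
  by apply: rspan_sum => // i; apply: rspanZ; apply: rspan_rep.
rewrite wE mulmx_sumr [RHS]mulmx_sum_row; apply: eq_bigr => i _.
by rewrite -scalemxAr rowK.
Qed.

(** If the columns [rho x *m u] did not span, a nonzero row [v] would annihilate them all. But [v]
    can be moved to any [delta_mx 0 j], so [u] would have only zero entries. *)
Lemma min_rep_col_transitive (u w : 'cV[F]_m) :
  u != 0 -> exists2 X, rspan rho X & X *m u = w.
Proof.
move=> u_neq0; pose e := vbasis {:A}.
pose V := \matrix_i (rho e`_i *m u)^T : 'M[F]_(\dim {:A}, m).
have V_full : row_full V.
  rewrite /row_full -mxrank_tr -[_ == _]/(row_free V^T) -kermx_eq0.
  apply: contraT => /rowV0Pn[v /sub_kermxP vV v_neq0].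
  have vu (i : 'I_(\dim {:A})) : v *m (rho e`_i *m u) = 0.
    have <- : col i (v *m V^T) = v *m (rho e`_i *m u).
      by rewrite colE -mulmxA -colE -tr_row rowK trmxK.
    by rewrite vV colE mul0mx.
  have /cV0Pn[j uj] := u_neq0.
  have [X /(rspan_basis rhoP)[x ->] vX] := min_rep_row_transitive (delta_mx 0 j) v_neq0.
  have /eqP[] := uj; have /(congr1 (fun M => (M *m u) 0 0)) := vX.
  rewrite -rowE [row j u 0 0]mxE => <-.
  rewrite mulmx_sumr mulmx_suml big1 ?mxE // => i _.
  by rewrite -scalemxAr -scalemxAl -mulmxA vu scaler0.
have [D wE] := submxP (submx_full w^T V_full).
exists (\sum_i D 0 i *: rho e`_i).
  by apply: rspan_sum => // i; apply: rspanZ; apply: rspan_rep.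
apply: trmx_inj; rewrite wE mulmx_sum_row mulmx_suml linear_sum.
by apply: eq_bigr => i _; rewrite -scalemxAl linearZ rowK.
Qed.

End Transitivity.

Lemma rep_map (F F' : fieldExtType Q) (f : {rmorphism F -> F'}) (m : nat)
    (rho : A -> 'M[F]_m) :
  (forall a : Q, f a%:A = a%:A) -> alg_rep rho ->
  alg_rep (fun x => map_mx f (rho x)).
Proof.
move=> fQ rhoP; split=> [a x y||x y].
- by rewrite (rep_linear rhoP) map_mxD map_mxZ fQ.
- by rewrite (rep1 rhoP) map_mx1.
- by rewrite (repM rhoP) map_mxM.
Qed.

Lemma rspan_map (F F' : fieldExtType Q) (f : {rmorphism F -> F'}) (m : nat)
    (rho : A -> 'M[F]_m) T :
  rspan rho T -> rspan (fun x => map_mx f (rho x)) (map_mx f T).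
Proof.
move=> [s ->]; exists [seq (f p.1, p.2) | p <- s].
by rewrite map_mx_sum big_map; apply: eq_bigr => p _; rewrite map_mxZ.
Qed.

(* Burnside's theorem in the form of Lomonosov and Rosenthal: a nonzero element
   T of minimal rank has rank 1, as otherwise some T X T - a T is nonzero of
   smaller rank, after adjoining an eigenvalue a. *)
Lemma min_rep_rank1 (m r : nat) :
  (forall (F : fieldExtType Q) (k : nat) (rho : A -> 'M[F]_k),
     alg_rep rho -> (0 < k)%N -> (m <= k)%N) ->
  (forall (F : fieldExtType Q) (rho : A -> 'M[F]_m) T,
     alg_rep rho -> rspan rho T -> T != 0 -> (r <= \rank T)%N) ->
  forall (F : fieldExtType Q) (rho : A -> 'M[F]_m) T,
    alg_rep rho -> rspan rho T -> T != 0 -> \rank T = r -> r = 1%N.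
Proof.
move=> m_min r_min F rho T rhoP TP T_neq0 rankT.
have r_gt0 : (0 < r)%N by rewrite -rankT lt0n mxrank_eq0.
case: r => [//|[//|r]] in r_min rankT r_gt0 *.
have [L [K [L_full K_free TE]]] : exists (L : 'M[F]_(m, r.+2)) (K : 'M[F]_(r.+2, m)),
    [/\ row_full L, row_free K & T = L *m K].
  rewrite -rankT; exists (col_base T), (row_base T).
  by rewrite col_base_full row_base_free mulmx_base.
have [L' L'L] := row_fullP L_full; have [K' KK'] := row_freeP K_free.
have u_neq0 : col 0 L != 0.
  apply/eqP => u0; have := congr1 (fun M => (L' *m M) 0 0) u0.
  rewrite [in LHS]colE mulmxA L'L mul1mx mulmx0 !mxE => /eqP.
  by rewrite oner_eq0.
(* [X] is chosen so that column 0 of [K *m X *m L] is [delta_mx 1 0]. The off-diagonal entry 1,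
   available as the rank is at least 2, keeps [Z] below from being 0. *)
have [X XP XE] := min_rep_col_transitive rhoP (fun k rho' => @m_min F k rho')
  (K' *m delta_mx 1 0) u_neq0.
have [Y YE Y10] : exists2 Y, Y = K *m X *m L & Y 1 0 = 1.
  exists (K *m X *m L) => //; have : col 0 (K *m X *m L) = delta_mx 1 0.
    by rewrite colE -!mulmxA -colE XE mulmxA KK' mul1mx.
  by move=> /(congr1 (fun M : 'cV_r.+2 => M 1 0)); rewrite mxE => ->; rewrite mxE.
have [|F' [f [fQ [z]]]] := @finite_extension_root Q F (char_poly Y).
  by rewrite size_char_poly.
rewrite map_char_poly -eigenvalue_root_char => z_eig.
pose Z := map_mx f Y - z%:M.
(* This is T X T - z T over the larger field; its rank drops because [Z] is singular. *)
pose S := map_mx f L *m Z *m map_mx f K.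
have SE : S = map_mx f (T *m X *m T) + (- z) *: map_mx f T.
  rewrite /S /Z mulmxBr mulmxBl mul_mx_scalar -scalemxAl scaleNr TE.
  by rewrite -!map_mxM YE !mulmxA.
have SP : rspan (fun x => map_mx f (rho x)) S.
  rewrite SE; apply: rspanD; first apply: rspan_map.
    by do 2!apply: rspanM => //.
  by apply: rspanZ; apply: rspan_map.
have S_neq0 : S != 0.
  apply/eqP => S0; have := congr1 (fun M => (map_mx f L' *m M *m map_mx f K') 1 0) S0.
  rewrite /S !mulmxA -map_mxM L'L map_mx1 mul1mx -mulmxA -map_mxM KK' map_mx1 mulmx1.
  by rewrite mulmx0 mul0mx !mxE Y10 rmorph1 subr0 => /eqP; rewrite oner_eq0.
have := r_min _ _ S (rep_map fQ rhoP) SP S_neq0.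
rewrite leqNgt (leq_ltn_trans (mxrankM_maxl _ _)) // (leq_ltn_trans (mxrankM_maxr _ _)) //.
by rewrite ltn_neqAle rank_leq_row andbT -[_ == _]/(row_free Z) -kermx_eq0.
Qed.

(** Irreducibility over every extension field, in the form given by Burnside's theorem. *)
Definition absolutely_irreducible (F : fieldExtType Q) (m : nat)
  (rho : A -> 'M[F]_m) := forall T, rspan rho T.

(** Take the least degree over all finite extensions, then the least rank of a nonzero matrix in the
    spans of that degree. This rank is 1, and transitivity on columns and rows moves a matrix
    [l *m v] to every matrix unit. *)
Lemma absolutely_irreducible_rep :
  exists (F : fieldExtType Q) (m : nat) (rho : A -> 'M[F]_m),
    [/\ (0 < m)%N, alg_rep rho & absolutely_irreducible rho].
Proof.
pose P m := (0 < m)%N /\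
  exists (F : fieldExtType Q) (rho : A -> 'M[F]_m), alg_rep rho.
have [|m [m_gt0 [F0 [rho0 rho0P]]] m_min] := @ex_min_nat P.
  exists (\dim {:A}); split; last by exists Q^o, (@left_mx Q A); apply: regular_rep.
  by rewrite lt0n dimv_eq0 -subv0; apply/negP => /subvP/(_ 1 (memvf _));
     rewrite memv0 oner_eq0.
have {}m_min (F : fieldExtType Q) (k : nat) (rho : A -> 'M[F]_k) :
  alg_rep rho -> (0 < k)%N -> (m <= k)%N.
  by move=> rhoP k_gt0; apply: m_min; split=> //; exists F, rho.
pose P' r := exists (F : fieldExtType Q) (rho : A -> 'M[F]_m) T,
  [/\ alg_rep rho, rspan rho T, T != 0 & \rank T = r].
have [|r [F [rho [T [rhoP TP T_neq0 rankT]]]] r_min] := @ex_min_nat P'.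
  exists m, F0, rho0, 1%:M; split=> //; last exact: mxrank1.
    by rewrite -(rep1 rho0P); apply: rspan_rep.
  by rewrite -mxrank_eq0 mxrank1 -lt0n.
have r1 : r = 1%N.
  apply: (min_rep_rank1 m_min) rhoP TP T_neq0 rankT => F' rho' T' *.
  by apply: r_min; exists F', rho', T'.
exists F, m, rho; split=> // S.
have [l [v TE]] : exists (l : 'cV[F]_m) (v : 'rV[F]_m), T = l *m v.
  have e1 : \rank T = 1%N by rewrite rankT.
  by move: (col_base T) (row_base T) (mulmx_base T); rewrite e1 => l v <-; exists l, v.
have l_neq0 : l != 0 by apply: contraNneq T_neq0 => l0; rewrite TE l0 mul0mx.
have v_neq0 : v != 0 by apply: contraNneq T_neq0 => v0; rewrite TE v0 mulmx0.
rewrite [S]matrix_sum_delta.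
apply: rspan_sum => // i; apply: rspan_sum => // j; apply: rspanZ.
have [X XP Xl] := min_rep_col_transitive rhoP (@m_min F) (delta_mx i 0) l_neq0.
have [Y YP vY] := min_rep_row_transitive rhoP (@m_min F) (delta_mx 0 j) v_neq0.
have <- : X *m T *m Y = delta_mx i j.
  by rewrite TE !mulmxA Xl -mulmxA vY mul_delta_mx.
by do 2!apply: rspanM => //.
Qed.

End MinimalRepresentation.

(** * Characteristic polynomials of left multiplications *)

Section BlockDiagonal.
Variables (F : fieldType) (n : nat).

Fixpoint copies_mx (k : nat) (B : 'M[F]_n) : 'M[F]_(k * n) :=
  if k is k'.+1 then block_mx B 0 0 (copies_mx k' B) else 0.

(** Families are indexed by [nat] so that the recursion can shift them; only the first [k] rows
    count. *)
Fixpoint concat_rows (k : nat) (Y : nat -> 'rV[F]_n) : 'rV[F]_(k * n) :=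
  if k is k'.+1 then row_mx (Y 0%N) (concat_rows k' (Y \o S)) else 0.

Lemma char_poly_copies k B : char_poly (copies_mx k B) = char_poly B ^+ k.
Proof.
elim: k => [|k IHk]; first by rewrite /char_poly det_mx00.
by rewrite /char_poly /= char_block_diag_mx det_ublock -!/(char_poly _) IHk exprS.
Qed.

Lemma mxtrace_copies k B : \tr (copies_mx k B) = k%:R * \tr B.
Proof.
elim: k => [|k IHk]; first by rewrite mul0r [copies_mx 0 B]flatmx0 mxtrace0.
by rewrite /= mxtrace_block IHk -natr1 mulrDl mul1r addrC.
Qed.

Lemma concat_rows_copies k Y B :
  concat_rows k Y *m copies_mx k B = concat_rows k (fun l => Y l *m B).
Proof.
elim: k Y => [|k IHk] Y /=; first by rewrite mul0mx.
by rewrite mul_row_block !mulmx0 addr0 add0r IHk.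
Qed.

Lemma concat_rows_sum (I : finType) k (a : I -> F) (Y : I -> nat -> 'rV[F]_n) :
  concat_rows k (fun l => \sum_i a i *: Y i l) =
  \sum_i a i *: concat_rows k (Y i).
Proof.
elim: k Y => [|k IHk] Y /=.
  by rewrite big1 // => i _; rewrite scaler0.
under [RHS]eq_bigr do rewrite scale_row_mx.
rewrite (IHk (fun i l => Y i l.+1)).
elim/big_rec3: _ => [|i y1 y2 y3 _ <-]; first by rewrite row_mx0.
by rewrite add_row_mx.
Qed.

Lemma eq_concat_rows k Y Y' : (forall l, (l < k)%N -> Y l = Y' l) ->
  concat_rows k Y = concat_rows k Y'.
Proof.
elim: k Y Y' => //= k IHk Y Y' YY'; rewrite YY' //; congr row_mx.
by apply: IHk => l lk; apply: YY'.
Qed.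

Lemma concat_rows0 k : concat_rows k (fun=> 0) = 0.
Proof. by elim: k => //= k IHk; rewrite [concat_rows k _]IHk row_mx0. Qed.

Lemma concat_rows_inj k Y Y' : concat_rows k Y = concat_rows k Y' ->
  forall l, (l < k)%N -> Y l = Y' l.
Proof.
elim: k Y Y' => // k IHk Y Y' /= /eq_row_mx[Y0 YS] [//|l].
exact: (IHk _ _ YS).
Qed.

Lemma concat_rows_surj k (v : 'rV[F]_(k * n)) : exists Y, concat_rows k Y = v.
Proof.
elim: k v => [|k IHk] v; first by exists (fun=> 0); rewrite [RHS]thinmx0.
have [Y YE] := IHk (rsubmx (v : 'rV_(n + k * n))).
exists (fun l => if l is l'.+1 then Y l' else lsubmx (v : 'rV_(n + k * n))) => /=.
by rewrite (_ : _ \o S = Y) ?YE ?hsubmxK.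
Qed.

End BlockDiagonal.

(** [S] is square and invertible; take determinants in (X - A) S = S (X - B) and cancel the
    determinant of [S]. *)
Lemma char_poly_intertwine (F : fieldType) (m n : nat) (A : 'M[F]_m)
    (B : 'M[F]_n) (S : 'M[F]_(m, n)) :
  row_free S -> row_full S -> A *m S = S *m B -> char_poly A = char_poly B.
Proof.
move=> S_free S_full; have mn : m = n.
  by rewrite -(eqP S_free) (eqP S_full).
case: n / mn in B S S_free S_full * => AS.
have detS : \det (map_mx polyC S) != 0.
  rewrite det_map_mx polyC_eq0 -unitfE -[_ \is a _]/(S \in unitmx).
  by rewrite -row_free_unit.
apply: (mulIf detS); rewrite -det_mulmx [RHS]mulrC -det_mulmx; congr (\det _).
rewrite /char_poly_mx mulmxBl mulmxBr -!map_mxM AS.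
by rewrite scalar_mxC.
Qed.

Section AbsolutelyIrreducible.
Variables (Q : fieldType) (A : falgType Q).
Hypothesis A_prime : prime_ring A.
Hypothesis A_central :
  forall z : A, (forall x, x * z = z * x) -> exists a, z = a%:A.
Variables (F : fieldExtType Q) (m : nat) (rho : A -> 'M[F]_m).
Hypotheses (m_gt0 : (0 < m)%N) (rhoP : alg_rep rho).

Local Notation e := (vbasis {:A}).

Lemma rep_mult_op s a :
  rho (mult_op s a) = \sum_(t <- s) rho t.1 *m rho a *m rho t.2.
Proof.
have rhoD x y : rho (x + y) = rho x + rho y.
  by rewrite -[x]scale1r (rep_linear rhoP) !scale1r.
rewrite /mult_op (big_morph rho rhoD (rep0 rhoP)).
by apply: eq_bigr => t _; rewrite !(repM rhoP).
Qed.

(** Faithfulness after extension of scalars: an operator sending the i-th basis vector to 1 and the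
    others to 0 turns the relation into [x i] times the identity, of positive size. *)
Lemma rep_free (x : 'I_(\dim {:A}) -> F) :
  \sum_i x i *: rho e`_i = 0 -> forall i, x i = 0.
Proof.
move=> sum0 i.
pose es := [seq e`_j | j : 'I_(\dim {:A}) <- [seq j <- enum 'I_(\dim {:A}) | j != i]].
have e_free : free e := basis_free (vbasisP _).
have eN : e`_i \notin <<es>>%VS.
  apply/negP => /(@coord_span _ _ _ (in_tuple es))/(congr1 (coord e i)).
  rewrite coord_free // eqxx linear_sum big1 => [|j _]; first by move/eqP; rewrite oner_eq0.
  rewrite linearZ /=; have : es`_j \in es by rewrite mem_nth // size_tuple.
  move=> /mapP[l]; rewrite mem_filter => /andP[li _] ->.
  by rewrite coord_free // (negPf li) mulr0.
have [s [si sj]] := mult_op_separate A_prime A_central eN.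
have : \sum_(t <- s) rho t.1 *m (\sum_j x j *: rho e`_j) *m rho t.2 = 0.
  by rewrite sum0 big1 // => t _; rewrite mulmx0 mul0mx.
under eq_bigr do rewrite mulmx_sumr mulmx_suml.
rewrite exchange_big (bigD1 i) //= [X in _ + X]big1 => [|j ji].
  under eq_bigr do rewrite -scalemxAr -scalemxAl.
  rewrite -scaler_sumr -rep_mult_op si (rep1 rhoP) addr0 => /matrixP xi.
  by have /esym := xi (Ordinal m_gt0) (Ordinal m_gt0); rewrite !mxE eqxx mulr1.
under eq_bigr do rewrite -scalemxAr -scalemxAl.
rewrite -scaler_sumr -rep_mult_op sj ?(rep0 rhoP) ?scaler0 //.
by apply/mapP; exists j; rewrite // mem_filter ji mem_enum.
Qed.

Hypothesis rho_irr : absolutely_irreducible rho.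

(** After extension of scalars A becomes the full matrix algebra, where left multiplication by
    [rho x] acts separately on the [m] columns. Transposes appear because matrices act on row
    vectors. *)
Lemma char_poly_left_mx x :
  map_poly (in_alg F) (char_poly (left_mx x)) = char_poly (rho x) ^+ m.
Proof.
have char_poly_tr k (B : 'M[F]_k) : char_poly B^T = char_poly B.
  rewrite /char_poly -det_tr; congr (\det _); apply/matrixP=> i j.
  by rewrite !mxE eq_sym.
rewrite map_char_poly -[LHS]char_poly_tr -[char_poly (rho x)]char_poly_tr.
rewrite -char_poly_copies.
(* Column [l] of the image of the j-th basis vector, written as a row; the default beyond [m] does
   not matter. *)
pose Y (j : 'I_(\dim {:A})) (l : nat) : 'rV[F]_m :=
  if insub l is Some l then row l (rho e`_j)^T else 0.
have YE (c : 'I_(\dim {:A}) -> F) l :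
    \sum_j c j *: Y j l = if insub l is Some l then row l (\sum_j c j *: rho e`_j)^T else 0.
  rewrite /Y; case: insub => [l'|]; last by rewrite big1 // => j _; rewrite scaler0.
  by rewrite !linear_sum; apply: eq_bigr => j _; rewrite !linearZ.
pose T := \matrix_j concat_rows m (Y j).
(* [T] is injective by [rep_free], surjective by [rho_irr]. *)
apply: (@char_poly_intertwine _ _ _ _ _ T).
- rewrite -kermx_eq0; apply: contraT => /rowV0Pn[c /sub_kermxP].
  rewrite mulmx_sum_row; under eq_bigr do rewrite rowK.
  rewrite -concat_rows_sum => c0 /rV0Pn[j] /eqP[].
  apply: (@rep_free (fun j => c 0 j) _ j); apply/trmx_inj/row_matrixP => l.
  have := concat_rows_inj (etrans c0 (esym (concat_rows0 F m m))) (ltn_ord l).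
  by rewrite YE valK trmx0 row0.
- rewrite -sub1mx; apply/row_subP => i.
  have [Z <-] := concat_rows_surj (row i (1%:M : 'M[F]_(m * m))).
  have [c cE] := rspan_basis rhoP (rho_irr (\matrix_l Z l : 'M_m)^T).
  have -> : concat_rows m Z = concat_rows m (fun l => \sum_j c j *: Y j l).
    apply: eq_concat_rows => l lm.
    by rewrite YE insubT -cE trmxK rowK.
  rewrite concat_rows_sum summx_sub // => j _; apply: scalemx_sub.
  by rewrite -[X in (X <= _)%MS](rowK (fun j => concat_rows m (Y j))) row_sub.
apply/row_matrixP => j; rewrite !row_mul [row j T]rowK concat_rows_copies.
rewrite mulmx_sum_row.
under eq_bigr do rewrite rowK 3!mxE.
rewrite -concat_rows_sum; apply: eq_concat_rows => l lm.
rewrite YE /Y insubT -row_mul -trmx_mul -(repM rhoP) left_mxE.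
congr (row _ _^T).
have rhoD y z : rho (y + z) = rho y + rho z.
  by rewrite -[y]scale1r (rep_linear rhoP) !scale1r.
rewrite (big_morph rho rhoD (rep0 rhoP)); apply: eq_bigr => i _.
by rewrite -[_ *: e`_i]addr0 (rep_linear rhoP) (rep0 rhoP) addr0.
Qed.

End AbsolutelyIrreducible.

(** * Rationality and integrality of traces *)

(** Adjoin one root at a time; the induction ranges over all fields. *)
Lemma poly_splits (F : fieldType) (p : {poly F}) : p \is monic ->
  exists (L : fieldType) (f : {rmorphism F -> L}) (s : seq L),
    map_poly f p = \prod_(x <- s) ('X - x%:P).
Proof.
have [m] := ubnP (size p); elim: m F p => // m IHm F p sz_p p_monic.
have [p_le1|/irreducible_divisor[d irr_d dp]] := leqP (size p) 1.
  exists F, idfun, [::]; rewrite big_nil map_poly_id //.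
  have pE := size1_polyC p_le1; move: p_monic; rewrite pE monicE lead_coefC.
  by move/eqP->.
have [L _ [z z_root _]] := irredp_FAdjoin irr_d.
have /factor_theorem[g gE] : root (map_poly (in_alg L) p) z.
  by apply: (root_dvdp _ z_root); rewrite dvdp_map.
have g_monic : g \is monic.
  by rewrite -(monicMr _ (monicXsubC z)) -gE map_monic.
have [|L' [f [s fs]]] := IHm L g _ g_monic.
  rewrite -ltnS; apply: leq_trans sz_p; rewrite -(size_map_poly (in_alg L)) gE.
  by rewrite size_Mmonic ?monicXsubC ?monic_neq0 // size_XsubC addn2.
exists L', (f \o in_alg L), (f z :: s).
rewrite map_poly_comp [X in map_poly f X]gE rmorphM /= fs big_cons.
by rewrite mulrC map_polyXsubC.
Qed.

Section TraceValues.
Variables (k : comNzRingType) (R : algType k) (C : comAlgType k).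
Variables (iota : {lrmorphism C -> R}) (Q : fieldType) (q : {rmorphism C -> Q}).
Variables (F : fieldExtType Q) (n : nat) (phi : {rmorphism R -> 'M[F]_n}).
Hypothesis phiP : splitting iota q phi.
Hypothesis n_gt0 : (0 < n)%N.

(** Otherwise the trace would vanish on pure tensors, hence on all matrices, whereas a diagonal
    matrix unit has trace 1. *)
Lemma splitting_trace_neq0 : exists r, \tr (phi r) != 0.
Proof.
apply: contrapT => /forallNP tr0.
have tr0' : forall X : 'M[F]_n, \tr X = 0.
  apply: (tensor_product_ext phiP).
  - by move=> X Y; rewrite linearB.
  - by move=> X Y; rewrite subr0.
  by move=> r x; rewrite linearZ /=; have /negP/negPn/eqP -> := tr0 r; rewrite mulr0.
have := tr0' (delta_mx (Ordinal n_gt0) (Ordinal n_gt0)).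
rewrite /mxtrace (bigD1 (Ordinal n_gt0)) //= big1 => [|i ni].
  by rewrite mxE !eqxx addr0 => /eqP; rewrite oner_eq0.
by rewrite mxE (negPf ni).
Qed.

(* The traces of the elements of R lie on a single Q-line of F: compose the
   trace with a Q-linear form F -> Q, and use the uniqueness of traces. *)
Lemma splitting_trace_line : exists (u : F) (a : R -> Q),
  forall r, \tr (phi r) = u * (a r)%:A.
Proof.
have [r0 tr0] := splitting_trace_neq0.
(* A coordinate form that does not vanish at this trace makes [lam] below nonzero. *)
have [i ti] : exists i, coord (vbasis {:F}) i (\tr (phi r0)) != 0.
  apply: contrapT => /forallNP t0; case/eqP: tr0.
  rewrite [LHS](coord_vbasis (memvf _)) big1 // => i _.
  by have /negP/negPn/eqP -> := t0 i; rewrite scale0r.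
pose a r := coord (vbasis {:F}) i (\tr (phi r)).
have [|c r|x y|lam lamP] := @splitting_trace_universal _ _ _ _ _ _ _ _ _ phiP (fun r => (a r)%:A).
- by move=> x y; rewrite /a rmorphD linearD linearD scalerDl.
- by rewrite /a (splitting_scale phiP) linearZ /= mulr_algl linearZ -scalerA.
- by rewrite /a !rmorphM mxtrace_mulC.
have lam0 : lam != 0.
  apply: contraNneq ti => lam0; have /eqP := lamP r0.
  by rewrite lam0 mul0r scaler_eq0 oner_eq0 orbF.
by exists lam^-1, a => r; rewrite lamP mulKf.
Qed.

(** The coefficient below the leading one in [char_poly B ^+ m] is [- (m%:R * \tr B)]. Its power of
    exponent [p ^ j] is a coefficient of [char_poly B ^+ n], hence lies in Q, and [m] is
    invertible. *)
Lemma char_poly_power_trace p m j (B : 'M[F]_n) : p \in [pchar F] ->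
  n = (m * p ^ j)%N -> m%:R != 0 :> F ->
  (exists P : {poly Q}, map_poly (in_alg F) P = char_poly B ^+ n) ->
  exists a : Q, \tr B ^+ (p ^ j) = a%:A.
Proof.
move=> pF nE m0 [P PE].
have coefj (i : nat) (S : {poly F}) l : (S ^+ (p ^ l))`_(i * p ^ l) = S`_i ^+ (p ^ l).
  elim: l i => [|l IHl] i; first by rewrite muln1.
  by rewrite expnSr mulnA exprM coef_poly_Frobenius // IHl -exprM.
have m_gt0 : (0 < m)%N by rewrite lt0n; apply: contraNneq m0 => ->.
have := congr1 (fun S : {poly F} => S`_((m * n).-1 * p ^ j)) PE.
have -> : char_poly B ^+ n = char_poly B ^+ m ^+ (p ^ j) by rewrite -exprM -nE.
rewrite coefj -char_poly_copies char_poly_trace ?muln_gt0 ?m_gt0 //.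
rewrite mxtrace_copies coef_map.
rewrite -mulNr exprMn => coefE.
exists (P`_((m * n).-1 * p ^ j) / (- m%:R) ^+ (p ^ j)).
rewrite -[RHS]/(in_alg F _) fmorph_div coefE rmorphXn rmorphN rmorph_nat.
by rewrite mulrC mulKf // expf_neq0 // oppr_eq0.
Qed.

Hypothesis char_poly_phi : forall r,
  exists P : {poly Q}, map_poly (in_alg F) P = char_poly (phi r) ^+ n.

(** All traces lie on one Q-line, so a single nonzero rational trace suffices: that of 1 if [n] is
    nonzero in F, and any nonzero trace in the remaining case. *)
Lemma splitting_trace_rational r : exists a : Q, \tr (phi r) = a%:A.
Proof.
have [u [a trE]] := splitting_trace_line.
suff [r0 [b bE tr0]] : exists r0, exists2 b : Q, \tr (phi r0) = b%:A & \tr (phi r0) != 0.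
  have a0 : a r0 != 0.
    by apply: contraNneq tr0 => a0; rewrite trE a0 scale0r mulr0.
  have uE : u = (b / a r0)%:A.
    have a0F : (a r0)%:A != 0 :> F by rewrite scaler_eq0 oner_eq0 orbF.
    apply: (mulIf a0F); rewrite -trE bE mulr_algr scalerA mulrC divfK //.
  by exists (b / a r0 * a r); rewrite trE uE mulr_algl scalerA.
have [nF|nF] := eqVneq (n%:R : F) 0; last first.
  by exists 1; exists n%:R; rewrite rmorph1 mxtrace1 // scaler_nat.
have [p pF] := natf0_pchar n_gt0 (introT eqP nF).
have [r0 tr0] := splitting_trace_neq0; exists r0.
have p_prime := pcharf_prime pF.
have [m pm nE] := pfactor_coprime p_prime n_gt0.
have mF : m%:R != 0 :> F by rewrite -(dvdn_pcharf pF) -prime_coprime.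
have [b1 b1E] := char_poly_power_trace pF nE mF (char_poly_phi r0).
set t := \tr (phi r0) in tr0 b1E *.
have a0 : a r0 != 0.
  by apply: contraNneq tr0 => a0; rewrite /t trE a0 scale0r mulr0.
(* The trace of [r0 ^+ p] is [t ^+ p], and its ratio to [t] is rational since both lie on the
   Q-line. *)
pose c := a (r0 ^+ p) / a r0.
have cE : t ^+ p.-1 = c%:A.
  apply: (mulfI tr0); rewrite -exprS prednK ?prime_gt0 //.
  rewrite -mxtrace_Frobenius // -rmorphXn trE /t trE -mulrA; congr (_ * _).
  by rewrite mulr_algl scalerA /c mulrC divfK.
have c0 : c != 0.
  have : t ^+ p.-1 != 0 by apply: expf_neq0.
  by rewrite cE scaler_eq0 oner_eq0 orbF.
(* By the geometric sum, [t ^+ (p ^ logn p n)] is t times the s-th power of [t ^+ p.-1], so that [t]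
   is [b1 / c ^+ s]. *)
pose s := (\sum_(i < logn p n) p ^ i)%N.
have pE : (p ^ logn p n = (p.-1 * s).+1)%N.
  by rewrite -predn_exp prednK // expn_gt0 prime_gt0.
exists (b1 / c ^+ s) => //.
have cs0 : (c ^+ s)%:A != 0 :> F by rewrite scaler_eq0 oner_eq0 orbF expf_neq0.
apply: (mulIf cs0); rewrite [RHS]mulr_algr scalerA [c ^+ s * _]mulrC divfK ?expf_neq0 //.
have csE : (c ^+ s)%:A = c%:A ^+ s :> F := rmorphXn (in_alg F) s c.
by rewrite -b1E csE -cE -exprM pE exprS.
Qed.

(** The trace is the sum of the eigenvalues in a splitting field. Each of them is also an eigenvalue
    of the matrix [M] over C by which [r] acts on the generators, hence a root of the monic
    [char_poly M]. *)
Lemma splitting_trace_integral r : module_finitely_generated iota ->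
  integralOver (in_alg F \o q) (\tr (phi r)).
Proof.
move=> [l [g ggen]].
have /choice[a aE] j := ggen (r * g j).
pose M := \matrix_(i, j) a j i.
have [L [f [s fs]]] := poly_splits (char_poly_monic (phi r)).
pose h : {rmorphism C -> L} := f \o (in_alg F \o q).
have phi_iota c x : map_mx f (phi (iota c * x)) = h c *: map_mx f (phi x).
  by rewrite (splitting_scale phiP) map_mxZ.
have s_int x : x \in s -> integralOver h x.
  move=> xs; have : eigenvalue (map_mx f (phi r)) x.
    by rewrite eigenvalue_root_char -map_char_poly fs root_prod_XsubC.
  case/eigenvalueP=> v vx v0.
  (* The nonzero columns of [W] become eigenvectors for [M]; [W] is nonzero because 1 is a
     combination of the [g j]. *)
  pose W := \matrix_j (v *m map_mx f (phi (g j))).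
  have WM : (map_mx h M)^T *m W = x *: W.
    apply/row_matrixP => j; rewrite row_mul linearZ /= rowK mulmx_sum_row.
    rewrite scalemxAl -vx -mulmxA -map_mxM -[phi r *m _]/(phi r * phi (g j)).
    rewrite -rmorphM aE rmorph_sum map_mx_sum mulmx_sumr; apply: eq_bigr => i _.
    by rewrite phi_iota -scalemxAr rowK !mxE.
  have W0 : W != 0.
    apply: contraNneq v0 => W0; have [c c1] := ggen 1.
    rewrite -[v]mulmx1 -(map_mx1 f) -[1%:M]/(1 : 'M_n) -(rmorph1 phi) c1.
    rewrite rmorph_sum map_mx_sum mulmx_sumr big1 // => i _.
    rewrite phi_iota -scalemxAr -[v *m _](rowK (fun j => v *m map_mx f (phi (g j)))).
    by rewrite -/W W0 row0 scaler0.
  have [i [j Wij]] : exists i j, W i j != 0.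
    apply: contrapT => /forallNP W00; case/eqP: W0; apply/matrixP=> i j.
    by rewrite [RHS]mxE; have /forallNP/(_ j)/negP/negPn/eqP := W00 i.
  exists (char_poly M); first exact: char_poly_monic.
  rewrite map_char_poly -eigenvalue_root_char; apply/eigenvalueP.
  exists (col j W)^T; last first.
    by apply/rV0Pn; exists i; rewrite 2!mxE.
  apply: trmx_inj; rewrite trmx_mul trmxK linearZ /= trmxK.
  by rewrite -[map_mx h M]trmxK trmxK colE mulmxA WM -scalemxAl.
have size_s : size s = n.
  apply: succn_inj; rewrite -(size_prod_XsubC s id) -fs size_map_poly.
  exact: size_char_poly.
have trE : f (\tr (phi r)) = \sum_(x <- s) x.
  apply: oppr_inj; rewrite -rmorphN -char_poly_trace // -coef_map fs -[in LHS]size_s.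
  by rewrite coefPn_prod_XsubC // size_s -lt0n.
have [P P_monic Pr] : integralOver h (f (\tr (phi r))).
  rewrite trE big_seq; elim/big_rec: _ => [|x y xs]; first exact: integral0.
  exact: integral_add (s_int x xs).
by exists P => //; move: Pr; rewrite map_poly_comp fmorph_root.
Qed.

Lemma splitting_trace_in :
  module_finitely_generated iota ->
  (forall x : Q, integralOver q x -> exists c : C, x = q c) ->
  forall r, exists c, (q c)%:A = \tr (phi r).
Proof.
move=> fg normal r; have [a aE] := splitting_trace_rational r.
have [P P_monic Pr] := splitting_trace_integral r fg.
have [|c cE] := normal a; last by exists c; rewrite aE cE.
exists P => //; move: Pr; rewrite aE map_poly_comp -in_algE.
by rewrite fmorph_root.
Qed.

End TraceValues.

(** * Localization and splitting *)

Lemma common_denominator (C : comNzRingType) (Q : fieldType)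
    (q : {rmorphism C -> Q}) (I : finType) (x : I -> Q) :
  is_fraction_field q ->
  exists2 t, q t != 0 & exists c : I -> C, forall i, q t * x i = q (c i).
Proof.
move=> [qI qfrac]; have /choice[a /choice[b abE]] i := qfrac (x i).
have q0 c : c != 0 -> q c != 0.
  by apply: contraNneq => c0; apply/eqP/qI; rewrite c0 rmorph0.
exists (\prod_i b i).
  by rewrite rmorph_prod; apply/prodf_neq0 => i _; have [/q0] := abE i.
exists (fun i => a i * \prod_(j | j != i) b j) => i.
have [/q0 bi ->] := abE i.
by rewrite (bigD1 i) //= !rmorphM [q (b i) * _]mulrC -mulrA [q (b i) * _]mulrC divfK // mulrC.
Qed.

Section Localization.
Variables (k : comNzRingType) (R : algType k) (C : comAlgType k).
Variables (iota : {lrmorphism C -> R}) (Q : fieldType) (q : {rmorphism C -> Q}).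
Hypothesis qP : is_fraction_field q.
Hypothesis iotaP : central_subalgebra iota.

Let iotaC c r : iota c * r = r * iota c. Proof. by case: iotaP. Qed.

Section TensorBasis.
Variables (F : fieldExtType Q) (n : nat) (phi : {rmorphism R -> 'M[F]_n}).
Variables (N : nat) (e : 'I_N -> R).
Hypothesis phiZ : forall c r, phi (iota c * r) = (q c)%:A *: phi r.
Hypothesis e_free : forall x : 'I_N -> F,
  \sum_i x i *: phi (e i) = 0 -> forall i, x i = 0.
Hypothesis e_span : forall X, exists x : 'I_N -> F, X = \sum_i x i *: phi (e i).
Hypothesis e_gen : forall r, exists2 t, q t != 0 &
  exists c : 'I_N -> C, iota t * r = \sum_i iota (c i) * e i.

(** The [phi (e i)] form an F-basis of the matrices, so the factorization of a balanced map is
    forced: expand in this basis and apply [f] to the [e i]. *)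
Lemma splitting_basis : splitting iota q phi.
Proof.
split.
  split=> [r r' x|r x x'|c r x]; first by rewrite rmorphD scalerDr.
    by rewrite scalerDl.
  by rewrite phiZ scalerA mulr_algr.
move=> V f [fD fD' fZ].
have /choice[x xE] := e_span.
have x_uniq y X : X = \sum_i y i *: phi (e i) -> x X =1 y.
  move=> XE i; apply/eqP; rewrite -subr_eq0; apply/eqP.
  apply: (e_free (x := fun i => x X i - y i)).
  under eq_bigr do rewrite scalerBl.
  by rewrite sumrB -xE -XE subrr.
have f0 r : f r 0 = 0 by apply: (addIr (f r 0)); rewrite -fD' !add0r.
have fB r y z : f r (y - z) = f r y - f r z.
  by apply: (addIr (f r z)); rewrite -fD' !subrK.
have f0l y : f 0 y = 0 by apply: (addIr (f 0 y)); rewrite -fD !add0r.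
pose g X := \sum_i f (e i) (x X i).
have gB : zmod_morphism g.
  move=> X Y; rewrite /g -sumrB; apply: eq_bigr => i _; rewrite -fB.
  congr (f _ _); apply: (x_uniq (fun i => x X i - x Y i)) => {i}.
  under eq_bigr do rewrite scalerBl.
  by rewrite sumrB -!xE.
pose G : {additive 'M[F]_n -> V} :=
  HB.pack g (GRing.isZmodMorphism.Build 'M[F]_n V g gB).
(* Clear denominators: [f] trades a factor [q t] of [y] for [iota t] on [r], and [iota t * r] is a
   combination of the [e i]. *)
have GE r y : G (y *: phi r) = f r y.
  have [t t0 [c cE]] := e_gen r.
  have t0F : (q t)%:A != 0 :> F by rewrite scaler_eq0 oner_eq0 orbF.
  rewrite -[G _]/(g _) /g.
  have yE : y = q t *: (y / (q t)%:A).
    by rewrite -[RHS]mulr_algl [RHS]mulrC divfK.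
  rewrite [in RHS]yE -fZ cE.
  rewrite (big_morph (fun r => f r _) (fun r r' => fD r r' _) (f0l _)).
  apply: eq_bigr => i _; rewrite fZ; congr (f _ _).
  apply: (x_uniq (fun i => q (c i) *: (y / (q t)%:A))) => {i}.
  under eq_bigr do rewrite -[q _ *: _]mulr_algr -scalerA -phiZ.
  by rewrite -scaler_sumr -rmorph_sum -cE phiZ scalerA divfK.
exists G; split=> [r y|h hE X]; first exact: GE.
rewrite [X]xE !raddf_sum; apply: eq_bigr => i _.
by rewrite GE hE.
Qed.

End TensorBasis.
Hypothesis R_prime : prime_ring R.

Lemma iota_torsion_free c r : c != 0 -> iota c * r = 0 -> r = 0.
Proof.
move=> c0 cr; have [|ic|//] := @R_prime (iota c) r.
  by move=> x; rewrite iotaC -mulrA cr mulr0.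
by case/eqP: c0; apply: (proj1 iotaP); rewrite ic rmorph0.
Qed.

Let qI : injective q. Proof. by case: qP. Qed.

Let q0 c : (q c == 0) = (c == 0).
Proof.
by apply/eqP/eqP => [c0|->]; [apply: qI; rewrite c0 rmorph0|rewrite rmorph0].
Qed.

Let prod0 (I : finType) (P : pred I) (s : I -> C) :
  (forall i, s i != 0) -> \prod_(i | P i) s i != 0.
Proof.
by move=> s0; rewrite -q0 rmorph_prod; apply/prodf_neq0 => i _; rewrite q0.
Qed.

(** Take a maximal independent set of generators. By maximality each generator has a nonzero
    multiple in its span; [s] is the product of the multipliers. *)
Lemma rational_basis : module_finitely_generated iota ->
  exists (N : nat) (e : 'I_N -> R) (s : C), [/\ s != 0,
    forall a : 'I_N -> C, \sum_i iota (a i) * e i = 0 -> forall i, a i = 0 &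
    forall r, exists a : 'I_N -> C, iota s * r = \sum_i iota (a i) * e i].
Proof.
move=> [m [g ggen]].
pose free (B : {set 'I_m}) := `[< forall a : 'I_m -> C,
  \sum_(i in B) iota (a i) * g i = 0 -> forall i, i \in B -> a i = 0 >].
have free0 : free set0 by apply/asboolP => a _ i; rewrite inE.
case: (arg_maxnP (fun B : {set 'I_m} => #|B|) free0) => B /asboolP freeB maxB.
have gB i : exists s, s != 0 /\ exists a : 'I_m -> C,
    iota s * g i = \sum_(l in B) iota (a l) * g l.
  have [iB|iB] := boolP (i \in B).
    exists 1; split; first exact: oner_neq0.
    exists (fun l => (l == i)%:R); rewrite (bigD1 i) //= eqxx big1 ?addr0 // => l.
    by case/andP=> _ /negPf ->; rewrite rmorph0 mul0r.
  have /asboolP/existsNP[a] : ~~ free (i |: B).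
    by apply/negP => /maxB; rewrite /= cardsU1 iB add1n ltnn.
  move=> /not_implyP[sum0 /existsNP[l /not_implyP[lB /eqP al]]].
  rewrite big_setU1 //= in sum0.
  (* If [a i] were 0, the relation would live on the independent set [B]. *)
  exists (a i); split.
    apply: contraNneq al => ai; rewrite ai rmorph0 mul0r add0r in sum0.
    move: lB; rewrite !inE => /predU1P[->|lB]; first by rewrite ai.
    by apply/eqP/freeB.
  exists (fun l => - a l); under eq_bigr do rewrite rmorphN mulNr.
  by rewrite sumrN; apply/eqP; rewrite -addr_eq0 sum0.
have /choice[s sP] := gB; have s0 i : s i != 0 by have [] := sP i.
have /choice[a aE] i := proj2 (sP i).
pose S := \prod_i s i.
exists #|B|, (fun i => g (enum_val i)), S; split=> [|b|r]; first exact: prod0.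
  move=> sum0 i.
  pose b' l := if [pick i | enum_val i == l] is Some i then b i else 0.
  have b'E j : b' (enum_val j) = b j.
    by rewrite /b'; case: pickP => [j' /eqP/enum_val_inj -> //|/(_ j)/eqP].
  rewrite -b'E; apply: freeB (enum_valP i).
  by rewrite big_enum_val /= -[RHS]sum0; apply: eq_bigr => j _; rewrite b'E.
have [c ->] := ggen r.
exists (fun i => \sum_j c j * \prod_(l | l != j) s l * a j (enum_val i)).
rewrite -(big_enum_val (fun l => iota (\sum_j c j * \prod_(l | l != j) s l * a j l) * g l)) /=.
under [RHS]eq_bigr do rewrite rmorph_sum mulr_suml.
rewrite exchange_big mulr_sumr; apply: eq_bigr => j _ /=.
under [RHS]eq_bigr do rewrite rmorphM -mulrA.
rewrite -mulr_sumr -aE mulrA -rmorphM mulrA -rmorphM.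
by congr (iota _ * _); rewrite /S (bigD1 j) //= mulrC [s j * _]mulrC mulrA.
Qed.

(** R acts by left multiplication on coordinate vectors over Q; A is realized as the Q-span of the
    resulting matrices, a finite-dimensional matrix algebra. *)
Lemma localization : module_finitely_generated iota ->
  exists (A : falgType Q) (j : {rmorphism R -> A}),
    [/\ forall c r, j (iota c * r) = q c *: j r, injective j &
        forall x, exists2 t, q t != 0 & exists r, q t *: x = j r].
Proof.
move=> /rational_basis[N [e [s [s0 e_free e_gen]]]].
have qs0 : q s != 0 by rewrite q0.
have /choice[c cE] := e_gen.
have c_uniq a a' : \sum_(i < N) iota (a i) * e i = \sum_i iota (a' i) * e i -> a =1 a'.
  move/eqP; rewrite -subr_eq0 -sumrB => /eqP aa' i.
  apply/eqP; rewrite -subr_eq0; apply/eqP.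
  apply: (e_free (fun i => a i - a' i)); rewrite -[RHS]aa'.
  by apply: eq_bigr => l _; rewrite rmorphB mulrBl.
(* Coordinates in the Q-basis e of the localization of R. *)
pose K r : 'cV[Q]_N := \col_i (q (c r i) / q s).
have KD x y : K (x + y) = K x + K y.
  apply/colP => i; rewrite !mxE -mulrDl -rmorphD; congr (q _ / _).
  apply: (c_uniq (c (x + y)) (fun i => c x i + c y i)) => {i}.
  rewrite -cE mulrDr !cE -big_split; apply: eq_bigr => i _.
  by rewrite rmorphD mulrDl.
have KZ a x : K (iota a * x) = q a *: K x.
  apply/colP => i; rewrite !mxE mulrA -rmorphM; congr (q _ / _).
  apply: (c_uniq (c (iota a * x)) (fun i => a * c x i)) => {i}.
  rewrite -cE mulrA -iotaC -mulrA cE mulr_sumr; apply: eq_bigr => i _.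
  by rewrite rmorphM mulrA.
have K0 : K 0 = 0 by apply: (addIr (K 0)); rewrite -KD !add0r.
have K_inj x : K x = 0 -> x = 0.
  move=> Kx; apply: (iota_torsion_free s0); rewrite cE big1 // => i _.
  move/colP/(_ i)/eqP: Kx; rewrite !mxE mulf_eq0 invr_eq0 (negPf qs0) orbF q0.
  by move/eqP->; rewrite rmorph0 mul0r.
have Ke i : K (e i) = delta_mx i 0.
  apply/colP => l; rewrite !mxE eqxx andbT.
  have -> : c (e i) l = s * (l == i)%:R.
    apply: (c_uniq (c (e i)) (fun l => s * (l == i)%:R)) => {l}.
    rewrite -cE (bigD1 i) //= eqxx mulr1 big1 ?addr0 // => l /negPf ->.
    by rewrite mulr0 rmorph0 mul0r.
  by rewrite rmorphM mulrAC divff // mul1r rmorph_nat.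
have K_sum x : q s *: K x = \sum_i q (c x i) *: K (e i).
  by rewrite -KZ cE (big_morph K KD K0); apply: eq_bigr => i _; rewrite KZ.
pose L r : 'M[Q]_N := \matrix_(i, l) K (r * e l) i 0.
have LE r l : col l (L r) = K (r * e l) by apply/colP => i; rewrite !mxE.
(* Checked after scaling by [q s], which turns [x] into a combination of the [e i]. *)
have LK r x : L r *m K x = K (r * x).
  apply: (scalerI qs0); rewrite scalemxAr K_sum -KZ mulrA iotaC -mulrA cE.
  rewrite mulmx_sumr mulr_sumr (big_morph K KD K0); apply: eq_bigr => i _.
  by rewrite Ke -scalemxAr -colE LE mulrA -iotaC -mulrA KZ.
have L_ext (X Y : 'M[Q]_N) : (forall l, col l X = col l Y) -> X = Y.
  move=> XY; apply/matrixP => i l; have /colP/(_ i) := XY l.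
  by rewrite [LHS]mxE [RHS]mxE.
have LD x y : L (x + y) = L x + L y.
  by apply: L_ext => l; rewrite linearD /= !LE mulrDl KD.
have LZ a x : L (iota a * x) = q a *: L x.
  by apply: L_ext => l; rewrite linearZ /= !LE -mulrA KZ.
have LM x y : L (x * y) = L x *m L y.
  by apply: L_ext => l; rewrite LE colE -mulmxA -colE LE LK mulrA.
have L1 : L 1 = 1%:M.
  by apply: L_ext => l; rewrite LE mul1r Ke colE mul1mx.
have L0 : L 0 = 0 by apply: (addIr (L 0)); rewrite -LD !add0r.
have L_inj x : L x = 0 -> x = 0.
  by move=> Lx; apply: K_inj; rewrite -[x]mulr1 -LK Lx mul0mx.
have N_gt0 : (0 < N)%N.
  rewrite lt0n; apply/eqP => N0; have /eqP[] := oner_neq0 R; apply: K_inj.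
  by apply/colP => i; have := ltn_ord i; rewrite {2}N0.
have L_sum x : q s *: L x = \sum_i q (c x i) *: L (e i).
  by rewrite -LZ cE (big_morph L LD L0); apply: eq_bigr => i _; rewrite LZ.
(* Only the algebraic properties of [L] matter from here; [N] becomes a successor so that square
   matrices form a nonzero algebra. *)
clearbody L; clear LE LK K_sum Ke K_inj K0 KZ KD K.
case: N => // N in e e_free e_gen c cE c_uniq L L_ext LD LZ LM L1 L0 L_inj N_gt0 L_sum *.
pose U := <<[tuple L (e i) | i < N.+1]>>%VS.
have UZ t (X : 'M[Q]_N.+1) : q t != 0 -> q t *: X \in U -> X \in U.
  by move=> t0 /(memvZ (q t)^-1); rewrite scalerA mulVf // scale1r.
have LU r : L r \in U.
  apply: (UZ s) => //; rewrite L_sum; apply: rpred_sum => i _.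
  by apply/memvZ/memv_span/map_f; rewrite mem_enum.
have U_frac X : X \in U -> exists2 t, q t != 0 & exists r, q t *: X = L r.
  move=> /coord_span ->; have [t t0 [a aE]] := common_denominator
    (fun i => coord [tuple L (e i) | i < N.+1] i X) qP.
  exists t => //; exists (\sum_i iota (a i) * e i).
  rewrite scaler_sumr (big_morph L LD L0); apply: eq_bigr => i _.
  by rewrite LZ -aE scalerA -tnth_nth tnth_mktuple.
have U_aspace : is_aspace U.
  rewrite /is_aspace has_algid1 /=; last by rewrite -[1]/(1%:M) -L1.
  apply/prodvP => X Y /U_frac[t t0 [x xE]] /U_frac[t' t'0 [y yE]].
  apply: (UZ t) => //; apply: (UZ t') => //.
  by rewrite scalerAl scalerAr xE yE -[_ * _]/(_ *m _) -LM.
pose A : falgType Q := subvs_of (ASpace U_aspace).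
pose j0 r : A := vsproj U (L r).
have j0E r : vsval (j0 r) = L r by rewrite vsprojK.
have j0B : zmod_morphism j0.
  move=> x y; apply: val_inj; rewrite /= !j0E.
  by apply: (addIr (L y)); rewrite -LD !subrK.
have j0M : monoid_morphism j0.
  split=> [|x y]; apply: val_inj; rewrite /= !j0E.
    rewrite -[RHS]/(algid (ASpace U_aspace)) L1.
    by rewrite (unitr_algid1 (u := 1)) ?unitr1 // -[1]/(1%:M) -L1.
  exact: LM.
pose j : {rmorphism R -> A} := HB.pack j0
  (GRing.isZmodMorphism.Build R A j0 j0B) (GRing.isMonoidMorphism.Build R A j0 j0M).
exists A, j; split=> [a r|x y /eqP|x].
- by apply: val_inj; rewrite /= !j0E LZ.
- rewrite -subr_eq0 -rmorphB => /eqP jxy; apply/eqP; rewrite -subr_eq0.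
  by apply/eqP/L_inj; rewrite -j0E -[j0 _]/(j _) jxy.
have [t t0 [r rE]] := U_frac _ (subvsP x).
by exists t => //; exists r; apply: val_inj; rewrite /= j0E.
Qed.

End Localization.

(** * Existence of the reduced trace *)

Lemma reduced_trace_exists (k : comNzRingType) (R : algType k)
    (C : comAlgType k) (iota : {lrmorphism C -> R}) :
  central_subalgebra iota -> module_finitely_generated iota ->
  prime_ring R -> full_center iota -> normal_domain C ->
  exists tr : R -> C, is_reduced_trace iota tr.
Proof.
move=> iotaP fg R_prime R_center [Q [q [qP normal]]].
have [A [j [jZ j_inj j_frac]]] := localization qP iotaP R_prime fg.
have jC c : j (iota c) = (q c)%:A by rewrite -[iota c]mulr1 jZ rmorph1.
(* Primeness passes to A by clearing denominators; in the same way the center C of R gives the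
   center Q of A. *)
have A_prime : prime_ring A.
  move=> x y xy0; have [t t0 [r rE]] := j_frac x; have [t' t'0 [r' r'E]] := j_frac y.
  have [z|r0|r0] := R_prime r r'.
  - apply: j_inj; rewrite !rmorphM rmorph0 -rE -r'E -scalerAr -!scalerAl xy0.
    by rewrite !scaler0.
  - by left; apply: (scalerI t0); rewrite rE r0 rmorph0 scaler0.
  - by right; apply: (scalerI t'0); rewrite r'E r0 rmorph0 scaler0.
have A_central (z : A) : (forall x, x * z = z * x) -> exists a, z = a%:A.
  move=> zC; have [t t0 [r rE]] := j_frac z.
  have [|c cE] := R_center r.
    by move=> x; apply: j_inj; rewrite !rmorphM -rE -scalerAl -scalerAr zC.
  exists (q c / q t); apply: (scalerI t0).
  by rewrite rE cE jC scalerA mulrC divfK.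
have [F [n [rho [n_gt0 rhoP rho_irr]]]] := absolutely_irreducible_rep A.
pose phi0 r := rho (j r).
have rhoB x y : rho (x - y) = rho x - rho y.
  by rewrite addrC -scaleN1r (rep_linear rhoP) scaleN1r scaleN1r addrC.
have phiB : zmod_morphism phi0 by move=> x y; rewrite /phi0 rmorphB rhoB.
have phiM : monoid_morphism phi0.
  by split=> [|x y]; rewrite /phi0 ?rmorph1 ?(rep1 rhoP) // rmorphM (repM rhoP).
pose phi : {rmorphism R -> 'M[F]_n} := HB.pack phi0
  (GRing.isZmodMorphism.Build R 'M[F]_n phi0 phiB)
  (GRing.isMonoidMorphism.Build R 'M[F]_n phi0 phiM).
have rhoZ a x : rho (a *: x) = a%:A *: rho x.
  by rewrite -[a *: x]addr0 (rep_linear rhoP) (rep0 rhoP) addr0.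
have phiZ c r : phi (iota c * r) = (q c)%:A *: phi r.
  by rewrite -[LHS]/(rho _) jZ rhoZ.
(* Basis vectors of A, scaled by denominators into the image of R, supply the family for
   [splitting_basis]. *)
have /choice[t /all_and2[t0 /choice[e eE]]] (i : 'I_(\dim {:A})) :
    exists t, q t != 0 /\ exists r, q t *: (vbasis {:A})`_i = j r.
  by have [t t0 [r rE]] := j_frac (vbasis {:A})`_i; exists t; split=> //; exists r.
have t0F i : (q (t i))%:A != 0 :> F by rewrite scaler_eq0 oner_eq0 orbF.
have phie i : phi (e i) = (q (t i))%:A *: rho (vbasis {:A})`_i.
  by rewrite -[LHS]/(rho _) -eE rhoZ.
have phiP : splitting iota q phi.
  apply: (splitting_basis (e := e)) => // [x sum0 i|X|r].
  - have /(rep_free A_prime A_central n_gt0 rhoP)/(_ i)/eqP :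
        \sum_i (x i * (q (t i))%:A) *: rho (vbasis {:A})`_i = 0.
      by rewrite -[RHS]sum0; apply: eq_bigr => l _; rewrite phie scalerA.
    by rewrite mulf_eq0 (negPf (t0F i)) orbF => /eqP.
  - have [x ->] := rspan_basis rhoP (rho_irr X).
    exists (fun i => x i / (q (t i))%:A); apply: eq_bigr => i _.
    by rewrite phie scalerA divfK.
  have [s s0 [c cE]] := common_denominator
    (fun i => coord (vbasis {:A}) i (j r) / q (t i)) qP.
  exists s => //; exists c; apply: j_inj.
  rewrite jZ rmorph_sum [j r](coord_vbasis (memvf _)) scaler_sumr.
  by apply: eq_bigr => i _; rewrite jZ -cE -eE !scalerA -mulrA divfK.
have char_phi r : exists P : {poly Q},
    map_poly (in_alg F) P = char_poly (phi r) ^+ n.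
  exists (char_poly (left_mx (j r))).
  exact: (char_poly_left_mx A_prime A_central n_gt0 rhoP rho_irr).
have /choice[tr trE] := splitting_trace_in phiP n_gt0 char_phi fg normal.
by exists tr, Q, q, F, n, phi.
Qed.

Theorem theoremA (k : comNzRingType) (R : algType k) (C : comAlgType k)
    (iota : {lrmorphism C -> R}) (br : C -> C -> C) (d : C -> R -> R) :
  poisson_order iota br d ->
  (free_module iota ->
     (exists tr : R -> C, is_regular_trace iota tr) /\
     (forall tr : R -> C, is_regular_trace iota tr ->
        poisson_trace_order iota br d tr)) /\
  (prime_ring R -> pi_algebra R -> full_center iota -> normal_domain C ->
     (exists tr : R -> C, is_reduced_trace iota tr) /\
     (forall tr : R -> C, is_reduced_trace iota tr ->
        poisson_trace_order iota br d tr)).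
Proof.
move=> dP; have [iotaI iotaC] := order_central dP; split.
  move=> R_free; split=> [|tr]; first exact: regular_trace_exists dP R_free.
  exact: regular_trace_order.
move=> R_prime _ R_center C_normal; split.
  exact: reduced_trace_exists (order_central dP) (order_finite dP) _ _ _.
move=> tr [Q [q [F [n [phi [[qI _] phiP trP]]]]]].
exact: (reduced_trace_order phiP qI trP dP).
Qed.
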